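(* Let $n,k$ be positive integers, $d=2^n$, $\delta$ real, and let $|\Psi\rangle$ be drawn at random from an $\epsilon$-approximate state $k$-design $\nu$ on $(\mathbb{C}^2)^{\otimes n}$. Then $$\mathbb{P}_\nu\left(E_g(|\Psi\rangle)\le n-\delta\right)\le(1+\epsilon)\,2^{\,k\log_2(2k)+4n\log_2(10n)-k\delta+4n(n-\delta)}.$$ In particular, for $k=n^2$, $\delta=3\log_2 n+5$ and $\epsilon=1$, $$\mathbb{P}_\nu\left(E_g(|\Psi\rangle)\le n-3\log_2 n-5\right)\le 2\cdot n^{-n^2}.$$
   Context: The geometric measure of entanglement of an $n$-qubit pure state (unit vector) $|\Psi\rangle\in(\mathbb{C}^2)^{\otimes n}$ is $E_g(|\Psi\rangle)=-\log_2\sup_{\alpha\in\mathcal{P}}|\langle\alpha|\Psi\rangle|^2$, where $\mathcal{P}$ is the set of all product states $|\alpha_1\rangle\otimes\cdots\otimes|\alpha_n\rangle$ with each $|\alpha_i\rangle$ a unit vector in $\mathbb{C}^2$. Let $\nu_H$ be the uniform (unitarily invariant) distribution on unit vectors of $\mathbb{C}^d$. A probability distribution $\nu$ on unit vectors of $\mathbb{C}^d$ is an $\epsilon$-approximate state $k$-design if $$\left\|\mathbb{E}_{|\psi\rangle\sim\nu}\left[(|\psi\rangle\langle\psi|)^{\otimes k}\right]-\mathbb{E}_{|\psi\rangle\sim\nu_H}\left[(|\psi\rangle\langle\psi|)^{\otimes k}\right]\right\|_\infty\le\frac{\epsilon}{\binom{k+d-1}{d-1}},$$ where $\|\cdot\|_\infty$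 is the operator norm. $\mathbb{P}_\nu$ is probability for $|\Psi\rangle\sim\nu$. *)

(* Defs.v *)
From HB Require Import structures.
From mathcomp Require Import all_boot all_order all_algebra.
From mathcomp Require Import complex mxtens.
From mathcomp Require Import all_classical all_reals all_analysis.

Set Implicit Arguments.
Unset Strict Implicit.
Unset Printing Implicit Defensive.

Import Order.TTheory GRing.Theory Num.Theory.
Import numFieldNormedType.Exports.

Local Open Scope classical_set_scope.
Local Open Scope ring_scope.
Local Open Scope complex_scope.
Local Open Scope sesquilinear_scope.

(* The usual topology of the complex plane (balls of the modulus), so that
   'cV[R[i]]_d carries the topology of C^d. *)
HB.instance Definition _ (R : realType) := PseudoPointedMetric.copy R[i] R[i]^o.

(* C^d with its Borel sigma-algebra. *)
Notation borelC R d := (g_sigma_algebraType (@open 'cV[R[i]]_d)).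

Section Hilbert.
Context {R : realType}.

(* <u|v>, antilinear in u. *)
Definition braket {d} (u v : 'cV[R[i]]_d) : R[i] := (u ^t* *m v) 0 0.

Definition unit_vec {d} (v : 'cV[R[i]]_d) : Prop := braket v v = 1.

Definition vnorm {d} (v : 'cV[R[i]]_d) : R :=
  Num.sqrt (complex.Re (braket v v)).

Definition opnorm {d} (M : 'M[R[i]]_d) : R :=
  sup [set vnorm (M *m v) | v in [set v : 'cV[R[i]]_d | unit_vec v]].

End Hilbert.

Section Entanglement.
Context {R : realType}.

Definition log2 (x : R) : R := ln x / ln 2.

(* a 0 (x) a 1 (x) ... (x) a n; the recursion is that of ntensmx. *)
Fixpoint tensv_rec (a : nat -> 'cV[R[i]]_2) n : 'cV[R[i]]_(2 ^ n.+1) :=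
  if n is n'.+1 then a 0%N *t tensv_rec (fun i => a i.+1) n' else a 0%N.

(* a 0 (x) ... (x) a (n - 1); the other values of a are irrelevant. *)
Definition tensv (a : nat -> 'cV[R[i]]_2) n : 'cV[R[i]]_(2 ^ n) :=
  if n is n'.+1 return 'cV[R[i]]_(2 ^ n) then tensv_rec a n' else 1%:M.

Definition product_state {n} : set 'cV[R[i]]_(2 ^ n) :=
  [set tensv a n | a in [set a | forall i, unit_vec (a i)]].

Definition Eg {n} (psi : 'cV[R[i]]_(2 ^ n)) : R :=
  - log2 (sup [set Normc.normc (braket alpha psi) ^+ 2
              | alpha in product_state]).

End Entanglement.

Section Designs.
Context {R : realType} {d : nat}.
Implicit Types nu : probability (borelC R d) R.

Definition state_distribution nu : Prop :=
  nu [set psi : 'cV[R[i]]_d | unit_vec psi] = 1%E.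

Definition uniform_state_distribution nu : Prop :=
  state_distribution nu /\
  forall (U : 'M[R[i]]_d) (A : set (borelC R d)), U \is unitarymx ->
    measurable A -> nu [set psi : 'cV[R[i]]_d | A (U *m psi)] = nu A.

(* E[(|psi><psi|)^(x)k], entry by entry, real and imaginary parts. *)
Definition moment nu (k : nat) : 'M[R[i]]_(d ^ k) :=
  let T (psi : 'cV[R[i]]_d) := ntensmx (psi *m psi ^t*) k in
  \matrix_(x, y) ((\int[nu]_psi complex.Re (T psi x y))
               +i* (\int[nu]_psi complex.Im (T psi x y))).

Definition approx_state_design (nuH : probability (borelC R d) R)
    (k : nat) (eps : R) nu : Prop :=
  state_distribution nu /\
  opnorm (moment nu k - moment nuH k) <= eps / ('C(k + d - 1, d - 1))%:R.

End Designs.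

(* Main.v *)
(* Write d = 2^n and C = binom(k+d-1, d-1). No net of product states is needed.

   The entry of alpha^(x)k at a basis index depends only on the type of that index, i.e. on
   how many of the k copies of each qubit are in the state 1. There are (k+1)^n types.
   Grouping the terms of <alpha^(x)k|psi^(x)k> by type and applying the Cauchy-Schwarz
   inequality gives, simultaneously for all product states alpha,
     |<alpha|psi>|^(2k) <= sum_t |<1_t|psi^(x)k>|^2 / |t|,
   where 1_t is the indicator vector of the type t.

   For the uniform distribution, invariance under the phases of a line, differentiated at
   the trivial phase and polarized, shows that multiplication by a coordinate is adjoint to
   a multiple of a partial derivative. Hence the mixed moments E[psi_x conj(psi_y)] of degree
   k are nonnegative and have row sums 1/C, so that E|<1_t|psi^(x)k>|^2 <= |t| / C. For a
   design this becomes (1+eps) |t| / C, because the operator norm controls the quadratic form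
   at 1_t. Markov's inequality then gives
     P(E_g <= n - delta) <= 2^(k(n-delta)) (k+1)^n (1+eps) / C,
   and C >= 2^(nk) / k^k and (k+1)^n <= 2^k (10n)^(4n) conclude when delta <= n; when
   delta > n the event is null, because overlaps of unit vectors are at most 1. *)

Require Import Defs.
From mathcomp Require Import all_boot all_order all_algebra.
From mathcomp Require Import complex mxtens.
From mathcomp Require Import all_classical all_reals all_analysis.
From mathcomp Require Import measurable_realfun.
From mathcomp Require Import ring lra zify.

Set Implicit Arguments.
Unset Strict Implicit.
Unset Printing Implicit Defensive.

Import Order.TTheory GRing.Theory Num.Theory.
Import numFieldNormedType.Exports.

Local Open Scope classical_set_scope.
Local Open Scope ring_scope.
Local Open Scope complex_scope.
Local Open Scope sesquilinear_scope.

(** * Brackets and unit vectors in coordinates *)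

Section Brakets.
Context {R : realType} {d : nat}.
Implicit Types u v : 'cV[R[i]]_d.

Lemma mulJc (z : R[i]) : z^*%C * z = (Normc.normc z ^+ 2)%:C.
Proof.
case: z => a b /=; rewrite sqr_sqrtr ?addr_ge0 ?sqr_ge0//; simpc.
by rewrite !expr2 [b * a]mulrC subrr.
Qed.

Lemma normc_ge0 (z : R[i]) : 0 <= Normc.normc z.
Proof. by case: z => a b; rewrite sqrtr_ge0. Qed.

Lemma braketE u v : braket u v = \sum_a (u a 0)^*%C * v a 0.
Proof. by rewrite /braket mxE; apply: eq_bigr => a _; rewrite !mxE. Qed.

Lemma braket_norm v : braket v v = (\sum_a Normc.normc (v a 0) ^+ 2)%:C.
Proof. by rewrite braketE rmorph_sum; apply: eq_bigr => a _; rewrite mulJc. Qed.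

Lemma unit_vecP v : unit_vec v <-> \sum_a Normc.normc (v a 0) ^+ 2 = 1.
Proof. by rewrite /unit_vec braket_norm; split => [[]|->]. Qed.

Lemma unit_coord_le1 v a : unit_vec v -> Normc.normc (v a 0) <= 1.
Proof.
move=> /unit_vecP v1; rewrite -(@expr_le1 _ 2)// ?normc_ge0// -v1 (bigD1 a)//=.
by rewrite lerDl sumr_ge0// => b _; rewrite sqr_ge0.
Qed.

End Brakets.

(** * Continuity, measurability and boundedness of functions of a state *)

Section RealContinuity.
Context {R : realType} {T : topologicalType}.
Implicit Types f g : T -> R.

Lemma continuous_add f g : continuous f -> continuous g -> continuous (fun x => f x + g x).
Proof. by move=> cf cg x; apply: cvgD; [exact: cf|exact: cg]. Qed.

Lemma continuous_mul f g : continuous f -> continuous g -> continuous (fun x => f x * g x).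
Proof. by move=> cf cg x; apply: cvgM; [exact: cf|exact: cg]. Qed.

Lemma continuous_opp f : continuous f -> continuous (fun x => - f x).
Proof. by move=> cf x; apply: cvgN; exact: cf. Qed.

End RealContinuity.

Section Measurability.
Context {R : realType} {d : nat}.

Lemma re_coord_continuous (a : 'I_d) :
  continuous (fun M : 'cV[R[i]]_d => complex.Re (M a 0)).
Proof.
move=> /= M s /= /(nbhs_ballP (complex.Re (M a 0))) [e e0 es].
(* Radii of balls over [R[i]] are themselves elements of [R[i]]. *)
apply/nbhs_ballP; exists e%:C => /=; first by rewrite ltcR.
move=> N [_ /(_ a 0) MN]; apply: es => /=; move: MN; rewrite /ball /= -ltcR.
apply: le_lt_trans; rewrite -[X in complex.Re X - _]opprK.
have -> : complex.Re (- - M a 0) - complex.Re (N a 0) = complex.Re (M a 0 - N a 0).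
  by case: (M a 0) (N a 0) => [? ?] [? ?] /=; rewrite opprK.
exact: normc_ge_Re.
Qed.

Lemma im_coord_continuous (a : 'I_d) :
  continuous (fun M : 'cV[R[i]]_d => complex.Im (M a 0)).
Proof.
move=> /= M s /= /(nbhs_ballP (complex.Im (M a 0))) [e e0 es].
apply/nbhs_ballP; exists e%:C => /=; first by rewrite ltcR.
move=> N [_ /(_ a 0) MN]; apply: es => /=; move: MN; rewrite /ball /= -ltcR.
apply: le_lt_trans.
(* The imaginary part of z is minus the real part of iz, and multiplication by i preserves the
   modulus, so the bound on real parts applies. *)
have -> : complex.Im (M a 0) - complex.Im (N a 0)
          = - complex.Re ((M a 0 - N a 0) * 'i%C).
  by rewrite ReiNIm opprK; case: (M a 0) (N a 0) => [? ?] [? ?].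
rewrite normrN -[leRHS]mulr1 -(_ : `|'i%C| = 1 :> R[i]) -?normrM.
  exact: normc_ge_Re.
by rewrite normc_def /= expr0n expr1n add0r sqrtr1.
Qed.

Definition ccont (f : borelC R d -> R[i]) :=
  continuous (fun x : 'cV[R[i]]_d => complex.Re (f x)) /\
  continuous (fun x : 'cV[R[i]]_d => complex.Im (f x)).

Lemma continuous_measurable_borelC (f : 'cV[R[i]]_d -> R) :
  continuous f -> measurable_fun [set: borelC R d] f.
Proof.
move=> cf; apply: (measurability _ (RGenOpens.measurableE R)).
move=> _ [_ [x [y ->]] <-]; rewrite setTI; apply: sub_sigma_algebra.
by apply: open_comp; last exact: interval_open.
Qed.

Lemma ccont_coord (a : 'I_d) : ccont (fun M => M a 0).
Proof. by split; [exact: re_coord_continuous|exact: im_coord_continuous]. Qed.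

Lemma ccont_cst c : ccont (fun=> c).
Proof. by split; exact: cst_continuous. Qed.

Lemma ccontD f g : ccont f -> ccont g -> ccont (fun x => f x + g x).
Proof.
move=> [f1 f2] [g1 g2]; split.
- rewrite (_ : (fun _ => _) = (fun x => complex.Re (f x) + complex.Re (g x))).
    exact: (continuous_add f1 g1).
  by apply/funext => x; case: (f x) (g x) => [? ?] [? ?].
- rewrite (_ : (fun _ => _) = (fun x => complex.Im (f x) + complex.Im (g x))).
    exact: (continuous_add f2 g2).
  by apply/funext => x; case: (f x) (g x) => [? ?] [? ?].
Qed.

Lemma ccontM f g : ccont f -> ccont g -> ccont (fun x => f x * g x).
Proof.
move=> [f1 f2] [g1 g2]; split.
- rewrite (_ : (fun _ => _) = (fun x => complex.Re (f x) * complex.Re (g x)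
      + - (complex.Im (f x) * complex.Im (g x)))).
    exact: continuous_add (continuous_mul f1 g1) (continuous_opp (continuous_mul f2 g2)).
  by apply/funext => x; case: (f x) (g x) => [? ?] [? ?].
- rewrite (_ : (fun _ => _) = (fun x => complex.Re (f x) * complex.Im (g x)
      + complex.Im (f x) * complex.Re (g x))).
    exact: continuous_add (continuous_mul f1 g2) (continuous_mul f2 g1).
  by apply/funext => x; case: (f x) (g x) => [? ?] [? ?].
Qed.

Lemma ccont_conj f : ccont f -> ccont (fun x => (f x)^*%C).
Proof.
move=> [f1 f2]; split.
- rewrite (_ : (fun _ => _) = (fun x => complex.Re (f x))) //.
  by apply/funext => x; case: (f x).
- rewrite (_ : (fun _ => _) = (fun x => - complex.Im (f x))) //.
    exact: continuous_opp f2.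
  by apply/funext => x; case: (f x).
Qed.

(** Polynomials in the coordinates are unbounded on the whole space; a bound on the unit sphere
    gives integrability, since state distributions are concentrated there. *)
Definition sphere_bounded (f : borelC R d -> R[i]) :=
  exists B : R, forall x : 'cV[R[i]]_d, unit_vec x -> Normc.normc (f x) <= B.

Definition nice f := ccont f /\ sphere_bounded f.

Lemma nice_cst c : nice (fun=> c).
Proof. by split; [exact: ccont_cst|exists (Normc.normc c)]. Qed.

Lemma niceD f g : nice f -> nice g -> nice (fun x => f x + g x).
Proof.
move=> [mf [A fA]] [mg [B gB]]; split; first exact: ccontD.
by exists (A + B) => x ux; rewrite (le_trans (le_normcD _ _))// lerD ?fA ?gB.
Qed.

Lemma niceM f g : nice f -> nice g -> nice (fun x => f x * g x).
Proof.
move=> [mf [A fA]] [mg [B gB]]; split; first exact: ccontM.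
exists (A * B) => x ux; rewrite Normc.normcM ler_pM ?fA ?gB//.
all: by case: (f x) (g x) => [? ?] [? ?]; rewrite sqrtr_ge0.
Qed.

Lemma nice_conj f : nice f -> nice (fun x => (f x)^*%C).
Proof.
move=> [mf [A fA]]; split; first exact: ccont_conj.
by exists A => x /fA; apply: le_trans; case: (f x) => a b /=; rewrite sqrrN.
Qed.

Lemma nice_coord (a : 'I_d) : nice (fun M => M a 0).
Proof.
split; first exact: ccont_coord.
by exists 1 => x; exact: unit_coord_le1.
Qed.

Lemma nice_sum I (r : seq I) (F : I -> borelC R d -> R[i]) :
  (forall i, nice (F i)) -> nice (fun x => \sum_(i <- r) F i x).
Proof.
move=> nF; elim: r => [|i r IH].
  rewrite (_ : (fun _ => _) = fun=> 0); first exact: nice_cst.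
  by apply/funext => x; rewrite big_nil.
rewrite (_ : (fun _ => _) = fun x => F i x + \sum_(i <- r) F i x).
  exact: niceD.
by apply/funext => x; rewrite big_cons.
Qed.

Lemma nice_prod I (r : seq I) (F : I -> borelC R d -> R[i]) :
  (forall i, nice (F i)) -> nice (fun x => \prod_(i <- r) F i x).
Proof.
move=> nF; elim: r => [|i r IH].
  rewrite (_ : (fun _ => _) = fun=> 1); first exact: nice_cst.
  by apply/funext => x; rewrite big_nil.
rewrite (_ : (fun _ => _) = fun x => F i x * \prod_(i <- r) F i x).
  exact: niceM.
by apply/funext => x; rewrite big_cons.
Qed.

End Measurability.

(** * Expectations of complex functions *)

Section Expectation.
Context {R : realType} {d : nat} (mu : probability (borelC R d) R).
Context (smu : state_distribution mu).
Implicit Types f g : borelC R d -> R[i].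

Lemma measurable_unit : measurable [set x : borelC R d | unit_vec (x : 'cV[R[i]]_d)].
Proof.
have [m _] : nice (fun x : borelC R d => \sum_a (x a 0)^*%C * x a 0).
  by apply: nice_sum => a; apply: niceM; [apply: nice_conj|]; exact: nice_coord.
rewrite (_ : [set _ | _] = (fun x : borelC R d =>
    complex.Re (\sum_a (x a 0)^*%C * x a 0)) @^-1` [set 1]).
  by rewrite -[X in measurable X]setTI; exact: (continuous_measurable_borelC m.1).
apply/seteqP; split => x /=; rewrite -braketE; first by rewrite /unit_vec => ->.
by rewrite unit_vecP braket_norm.
Qed.

Lemma ae_unit (P : borelC R d -> Prop) :
  (forall x : 'cV[R[i]]_d, unit_vec x -> P x) -> {ae mu, forall x, P x}.
Proof.
move=> uP; exists (~` [set x : borelC R d | unit_vec (x : 'cV[R[i]]_d)]); split => //.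
- exact: measurableC measurable_unit.
- rewrite probability_setC; last exact: measurable_unit.
  by rewrite smu subee.
- by move=> x /= + ux; apply; exact: uP.
Qed.

Lemma integrable_sphere_bounded (f : borelC R d -> R) (B : R) :
  measurable_fun setT f ->
  (forall x : 'cV[R[i]]_d, unit_vec x -> `|f x| <= B) ->
  mu.-integrable setT (EFin \o f).
Proof.
move=> mf fB; apply/integrableP; split; first exact/measurable_EFinP.
apply: le_lt_trans.
  (* The bound has to be nonnegative; the maximum with 0 avoids deriving this for [B]. *)
  apply: (integral_le_bound (Num.max B 0)%:E) => //.
  - exact/measurable_EFinP.
  - by rewrite lee_fin le_max lexx orbT.
  - apply: ae_unit => x ux _.
    by rewrite lee_fin le_max fB.
rewrite [X in (_ * X)%E](_ : _ = 1%E) ?mule1 ?ltry//; exact: probability_setT.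
Qed.

Lemma normr_Re_le (z : R[i]) : `|complex.Re z| <= Normc.normc z.
Proof. by have := normc_ge_Re z; rewrite lecR. Qed.

Lemma normr_Im_le (z : R[i]) : `|complex.Im z| <= Normc.normc z.
Proof.
by case: z => a b /=; rewrite -sqrtr_sqr ler_wsqrtr// lerDr sqr_ge0.
Qed.

Lemma integrable_Re f : nice f -> mu.-integrable setT (EFin \o (fun x => complex.Re (f x))).
Proof.
move=> [[cf _] [B fB]]; apply: (@integrable_sphere_bounded _ B) => [|x ux].
  exact: continuous_measurable_borelC.
exact: le_trans (normr_Re_le _) (fB _ ux).
Qed.

Lemma integrable_Im f : nice f -> mu.-integrable setT (EFin \o (fun x => complex.Im (f x))).
Proof.
move=> [[_ cf] [B fB]]; apply: (@integrable_sphere_bounded _ B) => [|x ux].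
  exact: continuous_measurable_borelC.
exact: le_trans (normr_Im_le _) (fB _ ux).
Qed.

(** The two parts are integrated separately, as in the entries of [moment]. *)
Definition Ex f : R[i] :=
  (\int[mu]_x complex.Re (f x)) +i* (\int[mu]_x complex.Im (f x)).

(** The complement of the sphere is null. This is how the relation <v|v> = 1 enters the computation
    of moments. *)
Lemma eq_Ex f g : nice f -> nice g ->
  (forall x : 'cV[R[i]]_d, unit_vec x -> f x = g x) -> Ex f = Ex g.
Proof.
move=> [[f1 f2] _] [[g1 g2] _] fg; rewrite /Ex /Rintegral.
congr (fine _ +i* fine _); apply: ae_eq_integral => //;
  try (apply/measurable_EFinP; exact: continuous_measurable_borelC).
all: by apply: ae_unit => x ux _; rewrite fg.
Qed.

Lemma ExD f g : nice f -> nice g -> Ex (fun x => f x + g x) = Ex f + Ex g.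
Proof.
move=> nf ng; rewrite /Ex.
rewrite -[RHS]/(Complex (_ + _) (_ + _)) -!RintegralD//.
all: try exact: integrable_Re; try exact: integrable_Im.
by congr (_ +i* _); apply: eq_Rintegral => x _; case: (f x) (g x) => [? ?] [? ?].
Qed.

Lemma ExZ c f : nice f -> Ex (fun x => c * f x) = c * Ex f.
Proof.
move=> nf; rewrite /Ex; case: c => a b.
have iZ (k : R) (g : borelC R d -> R) : mu.-integrable setT (EFin \o g) ->
    mu.-integrable setT (EFin \o (fun x => k * g x)).
  by move=> ig; have := integrableZl measurableT k ig; apply: eq_integrable.
have iR := integrable_Re nf; have iI := integrable_Im nf.
rewrite -[RHS]/(Complex (_ - _) (_ + _)) -!RintegralZl//.
rewrite -RintegralB// -?RintegralD//; try exact: iZ.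
by congr (_ +i* _); apply: eq_Rintegral => x _; case: (f x) => [? ?].
Qed.

Lemma Ex_cst c : Ex (fun=> c) = c.
Proof.
rewrite /Ex !Rintegral_cst//= probability_setT /= !mulr1; by case: c.
Qed.

Lemma Ex_sum I (r : seq I) (F : I -> borelC R d -> R[i]) :
  (forall i, nice (F i)) ->
  Ex (fun x => \sum_(i <- r) F i x) = \sum_(i <- r) Ex (F i).
Proof.
move=> nF; elim: r => [|i r IH].
  rewrite (_ : (fun _ => _) = fun=> 0) ?Ex_cst ?big_nil//.
  by apply/funext => x; rewrite big_nil.
rewrite big_cons -IH -ExD//; last exact: nice_sum.
by congr Ex; apply/funext => x; rewrite big_cons.
Qed.

End Expectation.

(** * Change of variables by a unitary matrix *)

Section Invariance.
Context {R : realType} {d : nat} (mu : probability (borelC R d) R).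
Context (umu : uniform_state_distribution mu).

Lemma measurable_mulmx (U : 'M[R[i]]_d) :
  measurable_fun setT (fun x : borelC R d => (U *m x : borelC R d)).
Proof.
apply: (@measurability _ _ (borelC R d) (borelC R d) setT _ (@open 'cV[R[i]]_d)) => //.
move=> _ [A oA <-]; rewrite setTI; apply: sub_sigma_algebra.
apply: open_comp => // M _ B /= /nbhs_ballP[e /= e0 eB].
(* [K] exceeds the sum of the moduli in each row, so [U] maps the ball of radius [e / K] into the
   ball of radius [e]; the summand 1 makes [K] positive and the comparison strict. *)
pose K := 1 + \sum_i \sum_j `|U i j|.
have K0 : 0 < K by rewrite ltr_pwDl// sumr_ge0// => i _; exact: sumr_ge0.
apply/nbhs_ballP; exists (e / K) => /=; first exact: divr_gt0.
move=> N [_ MN]; apply: eB; split=> // i j; rewrite /ball /= !mxE -sumrB.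
apply: (le_lt_trans (ler_norm_sum _ _ _)).
apply: (@le_lt_trans _ _ (\sum_l `|U i l| * (e / K))).
  apply: ler_sum => l _; rewrite -mulrBr normrM ler_wpM2l//.
  exact/ltW/MN.
rewrite -mulr_suml mulrCA -[ltRHS]mulr1 ltr_pM2l// ltr_pdivrMr// mul1r.
rewrite /K [X in 1 + X](bigD1 i)//= addrCA ltrDl ltr_pwDl//.
by apply: sumr_ge0 => i' _; exact: sumr_ge0.
Qed.

(** The image measure of [mu] under [U] agrees with [mu] on measurable sets. *)
Lemma Ex_unitary (U : 'M[R[i]]_d) f : U \is unitarymx -> nice f ->
  nice (fun x => f (U *m x)) ->
  Ex mu (fun x => f (U *m x)) = Ex mu f.
Proof.
move=> uU nf nfU; have [smu inv] := umu; rewrite /Ex /Rintegral.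
have E (g : borelC R d -> R) : measurable_fun setT g ->
    mu.-integrable setT (EFin \o (fun x => g (U *m x))) ->
    (\int[mu]_x (g x)%:E = \int[mu]_x (g (U *m x))%:E)%E.
  move=> mg ig.
  rewrite -(@integral_pushforward _ _ _ _ _ _ (measurable_mulmx U) mu setT (EFin \o g)) //.
  + apply: eq_measure_integral; first exact: measurable_mulmx.
    by move=> mU A mA _; apply: esym; exact: (inv U).
  + exact/measurable_EFinP.
case: nf => [[f1 f2] _]; congr (fine _ +i* fine _); apply: esym.
  by apply: (E (fun x => complex.Re (f x)));
    [exact: continuous_measurable_borelC|exact: integrable_Re nfU].
by apply: (E (fun x => complex.Im (f x)));
  [exact: continuous_measurable_borelC|exact: integrable_Im nfU].
Qed.

End Invariance.

(** * Derivatives of products of affine functions *)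

Section FormalDerivative.
Context {K : comNzRingType} {I : Type}.
Implicit Types (f g h : I -> K) (s : seq I).

(* The derivative at [t = 0] of [\prod_(a <- s) (f a + t * g a)]. *)
Fixpoint lder f g s : K :=
  if s is a :: s' then g a * \prod_(b <- s') f b + f a * lder f g s' else 0.

(** The parameter t is written as ['X - 1]: the variable then stands for a phase, and t = 0 is the
    trivial phase 1. *)
Definition lpert f g s : {poly K} := \prod_(a <- s) ((f a)%:P + ('X - 1) * (g a)%:P).

Lemma lpert_horner f g s c :
  (lpert f g s).[c] = \prod_(a <- s) (f a + (c - 1) * g a).
Proof. by rewrite horner_prod; apply: eq_bigr => a _; rewrite !hornerE. Qed.

Lemma lpert_deriv1 f g s : (lpert f g s)^`().[1] = lder f g s.
Proof.
elim: s => [|a s IH]; first by rewrite /lpert big_nil -[1]/(1%:P) derivC horner0.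
rewrite /lpert big_cons -/(lpert f g s) derivM.
have -> : ((f a)%:P + ('X - 1) * (g a)%:P)^`() = (g a)%:P.
  rewrite derivD derivC add0r derivM derivC mulr0 addr0.
  by rewrite -polyC1 derivB derivX derivC subr0 mul1r.
rewrite hornerD !hornerM IH /= !hornerE.
by rewrite lpert_horner subrr mul0r addr0; under eq_bigr do rewrite mul0r addr0.
Qed.

(** [lder] is linear in the direction, and in the direction [f] itself it multiplies the product by
    its number of factors. *)
Lemma lder_sub f g s :
  lder f (fun a => f a - g a) s = (size s)%:R * \prod_(a <- s) f a - lder f g s.
Proof.
elim: s => [|a s IH] /=; first by rewrite mul0r subr0.
rewrite IH big_cons mulrS; ring.
Qed.

Lemma lder_sum f s J (r : seq J) (k : J -> K) (G : J -> I -> K) :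
  lder f (fun a => \sum_(j <- r) k j * G j a) s = \sum_(j <- r) k j * lder f (G j) s.
Proof.
elim: s => [|a s IH] /=; first by rewrite big1// => j _; rewrite mulr0.
rewrite IH mulr_suml mulr_sumr -big_split; apply: eq_bigr => j _ /=; ring.
Qed.

End FormalDerivative.

Lemma leq_size_deriv (K : nzRingType) (p : {poly K}) : (size p^`() <= (size p).-1)%N.
Proof. exact: size_poly. Qed.

(** The circle is infinite, so the difference has more roots than its size allows. *)
Lemma poly_eq_unit_circle {R : realType} (p q : {poly R[i]}) :
  (forall l : R[i], l^*%C * l = 1 -> p.[l] = q.[l]) -> p = q.
Proof.
move=> pq; apply/eqP; rewrite -subr_eq0; apply/eqP.
(* The Cayley transform sends the natural numbers injectively into the unit circle. *)
pose c (t : nat) : R[i] := (1 +i* t%:R) / (1 -i* t%:R).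
have nz (t : nat) (b : bool) : (1 +i* (if b then t%:R else - t%:R) : R[i]) != 0.
  by rewrite eq_complex /= oner_eq0.
have c1 t : (c t)^*%C * c t = 1.
  rewrite /c rmorphM fmorphV /= opprK mulrACA [X in X * _]mulrC.
  by rewrite mulrACA !mulfV ?mulr1 ?(nz t true) ?(nz t false).
have cI : injective c.
  move=> t s /eqP; rewrite /c eqr_div ?(nz _ false)//; simpc.
  rewrite eq_complex => /andP[_ /= /eqP ts].
  apply/eqP; rewrite -(eqr_nat R); apply/eqP.
  lra.
apply/eqP; apply: contraT => pq0.
have := @max_poly_roots _ (p - q) [seq c t | t <- iota 0 (size (p - q))] pq0.
rewrite map_inj_uniq ?iota_uniq ?size_map ?size_iota ?ltnn// => -> //.
by apply/allP => _ /mapP[t _ ->]; rewrite rootE hornerD hornerN pq ?subrr.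
Qed.

(** * Polynomials with random coefficients *)

Section ExpectedPolynomial.
Context {R : realType} {d : nat} (mu : probability (borelC R d) R).
Context (smu : state_distribution mu).
Implicit Types F G : borelC R d -> {poly R[i]}.

(** The uniform bound on the size allows the expectation to be taken coefficient by coefficient in
    one finite sum. *)
Definition nicep F := (forall i, nice (fun x => (F x)`_i)) /\
  exists N, forall x, (size (F x) <= N)%N.

Lemma nicep_cst f : nice f -> nicep (fun x => (f x)%:P).
Proof.
move=> nf; split; last by exists 1%N => x; exact: size_polyC_leq1.
move=> [|i].
  by rewrite (_ : (fun _ => _) = f)//; apply/funext => x; rewrite coefC.
rewrite (_ : (fun _ => _) = fun=> 0); first exact: nice_cst.
by apply/funext => x; rewrite coefC.
Qed.

Lemma nicep_X : nicep (fun=> 'X).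
Proof. by split; [move=> i; exact: nice_cst|exists (size ('X : {poly R[i]}))]. Qed.

Lemma nicepD F G : nicep F -> nicep G -> nicep (fun x => F x + G x).
Proof.
move=> [nF [N FN]] [nG [M GM]]; split.
  move=> i; rewrite (_ : (fun _ => _) = fun x => (F x)`_i + (G x)`_i).
    exact: niceD.
  by apply/funext => x; rewrite coefD.
exists (maxn N M) => x; rewrite (leq_trans (size_polyD _ _))// geq_max.
by rewrite !leq_max FN GM orbT.
Qed.

Lemma nicepM F G : nicep F -> nicep G -> nicep (fun x => F x * G x).
Proof.
move=> [nF [N FN]] [nG [M GM]]; split.
  move=> i; rewrite (_ : (fun _ => _) = fun x => \sum_(j < i.+1) (F x)`_j * (G x)`_(i - j)).
    by apply: nice_sum => j; exact: niceM.
  by apply/funext => x; rewrite coefM.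
exists (N + M)%N => x; rewrite (leq_trans (size_polyMleq _ _))//.
by rewrite (leq_trans (leq_pred _))// leq_add.
Qed.

Lemma nicep_prod I (r : seq I) (F : I -> borelC R d -> {poly R[i]}) :
  (forall i, nicep (F i)) -> nicep (fun x => \prod_(i <- r) F i x).
Proof.
move=> nF; elim: r => [|i r IH].
  rewrite (_ : (fun _ => _) = fun=> 1%:P).
    by apply: nicep_cst; exact: nice_cst.
  by apply/funext => x; rewrite big_nil.
rewrite (_ : (fun _ => _) = fun x => F i x * \prod_(i <- r) F i x).
  exact: nicepM.
by apply/funext => x; rewrite big_cons.
Qed.

(* Two polynomials that agree on the unit circle are equal, so that an identity valid
   for every phase can be differentiated at the phase 1. *)
Lemma Ex_horner_deriv F (c : R[i]) (m : nat) : nicep F ->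
  (forall l : R[i], l^*%C * l = 1 -> Ex mu (fun x => (F x).[l]) = l ^+ m * c) ->
  Ex mu (fun x => (F x)^`().[1]) = m%:R * c.
Proof.
move=> nF Fc; have [nFi [N FN]] := nF.
(* [P] is the expected polynomial: expectation commutes with evaluation and with the derivative at
   1, so the hypothesis fixes [P] on the circle. *)
pose P := \poly_(i < N) Ex mu (fun x => (F x)`_i).
have PE l : P.[l] = Ex mu (fun x => (F x).[l]).
  rewrite horner_poly (_ : (fun _ => _) = fun x => \sum_(i < N) l ^+ i * (F x)`_i).
    rewrite Ex_sum// => [|i]; last by apply: niceM => //; exact: nice_cst.
    by apply: eq_bigr => i _; rewrite ExZ// mulrC.
  apply/funext => x; rewrite (horner_coef_wide _ (FN x)).
  by apply: eq_bigr => i _; rewrite mulrC.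
have -> : Ex mu (fun x => (F x)^`().[1]) = P^`().[1].
  rewrite (_ : (fun _ => _) = fun x => \sum_(i < N) i.+1%:R * (F x)`_i.+1).
    rewrite Ex_sum// => [|i]; last by apply: niceM => //; exact: nice_cst.
    rewrite (@horner_coef_wide _ N); last first.
      by rewrite (leq_trans (leq_size_deriv _))// (leq_trans (leq_pred _))// size_poly.
    apply: eq_bigr => i _; rewrite expr1n mulr1 coef_deriv coef_poly ExZ// mulr_natl.
    case: ifPn => //; rewrite -leqNgt => Ni.
    rewrite (_ : (fun _ => _) = fun=> 0) ?Ex_cst//.
    by apply/funext => x; rewrite nth_default// (leq_trans (FN x)).
  apply/funext => x; rewrite (@horner_coef_wide _ N); last first.
    by rewrite (leq_trans (leq_size_deriv _))// (leq_trans (leq_pred _)).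
  by apply: eq_bigr => i _; rewrite expr1n mulr1 coef_deriv mulr_natl.
have -> : P = c *: 'X^m.
  by apply: poly_eq_unit_circle => l l1; rewrite PE Fc// hornerZ hornerXn mulrC.
by rewrite derivZ derivXn hornerZ hornerMn hornerXn expr1n mulrC.
Qed.

End ExpectedPolynomial.

(** * Integration by parts for a unitarily invariant distribution *)

Section PhaseUnitary.
Context {R : realType} {d : nat}.
Implicit Types u v : 'cV[R[i]]_d.

(* Multiplies the component along [u] by the phase [l]; it equals [1 + (l - 1) |u><u|]
   when [u] is a unit vector. *)
Definition phase_mx u (l : R[i]) : 'M[R[i]]_d :=
  1%:M + ((l - 1) / braket u u) *: (u *m u ^t* ).

Lemma conj_braket u v : (braket u v)^*%C = braket v u.
Proof.
rewrite !braketE rmorph_sum; apply: eq_bigr => a _.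
by rewrite rmorphM /= conjcK mulrC.
Qed.

(** With the projector Q = |u><u| / <u|u>, the product of the matrix and its adjoint is 1 + (|l|^2 -
    1) Q. *)
Lemma phase_mx_unitary u l : braket u u != 0 -> l^*%C * l = 1 ->
  phase_mx u l \is unitarymx.
Proof.
move=> u0 l1; apply/unitarymxP.
have PC : (u *m u ^t* ) ^t* = u *m u ^t*.
  by apply/matrixP => a b; rewrite !mxE rmorph_sum; apply: eq_bigr => c _;
     rewrite !mxE rmorphM /= conjCK mulrC.
have PP : (u *m u ^t* ) *m (u *m u ^t* ) = braket u u *: (u *m u ^t* ).
  rewrite mulmxA -(mulmxA u) [u ^t* *m u]mx11_scalar -/(braket u u).
  by rewrite mul_mx_scalar -scalemxAl.
have -> : (phase_mx u l) ^t* = 1%:M + ((l^*%C - 1) / braket u u) *: (u *m u ^t* ).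
  rewrite /phase_mx !linearD !linearZ /= !map_mxD map_mxZ; congr (_ + _).
    by rewrite trmx1 map_mx1.
  have cb : Num.conj (braket u u) = braket u u := conj_braket u u.
  by rewrite PC rmorphM fmorphV rmorphB rmorph1 /= cb.
rewrite /phase_mx mulmxDl mul1mx mulmxDr mulmx1 -!addrA; apply/eqP.
rewrite addrC -subr_eq0 addrK; apply/eqP.
rewrite -scalemxAl -scalemxAr PP !scalerA -!scalerDl.
apply/eqP; rewrite scaler_eq0; apply/orP; left; apply/eqP.
transitivity ((l^*%C * l - 1) / braket u u); first by field.
by rewrite l1 subrr mul0r.
Qed.

Lemma phase_mxE u l v a :
  (phase_mx u l *m v) a 0 = v a 0 + (l - 1) * (u a 0 * braket u v / braket u u).
Proof.
rewrite mulmxDl mul1mx mxE; congr (_ + _).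
rewrite -scalemxAl -mulmxA mxE mxE big_ord1 -/(braket u v).
by rewrite -!mulrA; congr (_ * _); rewrite mulrC mulrA.
Qed.

End PhaseUnitary.

Section IntegrationByParts.
Context {R : realType} {d : nat} (mu : probability (borelC R d) R).
Context (umu : uniform_state_distribution mu).
Let smu : state_distribution mu := umu.1.
Implicit Types (x y : seq 'I_d) (v : borelC R d).

Definition mono x v : R[i] := \prod_(a <- x) v a 0.

(* The formal partial derivative of [mono x] with respect to the coordinate [b]. *)
Definition dmono b x v : R[i] := lder (fun a => v a 0) (fun a => (a == b)%:R) x.

Lemma nice_mono x : nice (mono x).
Proof. by apply: nice_prod => a; exact: nice_coord. Qed.

Lemma nice_lder (f g : 'I_d -> borelC R d -> R[i]) x :
  (forall a, nice (f a)) -> (forall a, nice (g a)) ->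
  nice (fun v => lder (f^~ v) (g^~ v) x).
Proof.
move=> nf ng; elim: x => [|a x IH] /=; first exact: nice_cst.
by apply: niceD; apply: niceM => //; exact: nice_prod.
Qed.

Lemma nice_dmono b x : nice (dmono b x).
Proof.
apply: (nice_lder (f := fun a v => v a 0) (g := fun a _ => (a == b)%:R)) => a.
  exact: nice_coord.
exact: nice_cst.
Qed.

Lemma conj_lder (f g : 'I_d -> R[i]) x :
  (lder f g x)^*%C = lder (fun a => (f a)^*%C) (fun a => (g a)^*%C) x.
Proof.
elim: x => [|a x IH] /=; first exact: conjc0.
by rewrite rmorphD !rmorphM /= IH rmorph_prod.
Qed.

Lemma nice_braket u : nice (fun v : borelC R d => braket u v).
Proof.
rewrite (_ : (fun _ => _) = fun v => \sum_a (u a 0)^*%C * v a 0).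
  by apply: nice_sum => a; apply: niceM; [exact: nice_cst|exact: nice_coord].
by apply/funext => v; rewrite braketE.
Qed.

(* The first-order invariance of the expectation under the phases of the line spanned by
   [u], i.e. under the one-parameter group generated by [i |u><u|]. *)
Lemma Ex_lder_braket (u : 'cV[R[i]]_d) x y : braket u u != 0 ->
  let g v a := u a 0 * braket u v / braket u u in
  Ex mu (fun v => lder (fun a => v a 0) (g v) x * (mono y v)^*%C) =
  Ex mu (fun v => mono x v * (lder (fun a => v a 0) (g v) y)^*%C).
Proof.
move=> u0 g; pose cf (v : borelC R d) a := (v a 0)^*%C; pose cg v a := (g v a)^*%C.
have ng a : nice (g^~ a).
  apply: niceM; last exact: nice_cst.
  by apply: niceM; [exact: nice_cst|exact: nice_braket].
have ncf a : nice (cf^~ a) by apply: nice_conj; exact: nice_coord.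
have ncg a : nice (cg^~ a) by exact: nice_conj.
(* The conjugate coordinates move by [l^*], which is not polynomial in [l]. Multiplying each by [l]
   gives l cf + (1 - l) cg = cf + (l - 1) (cf - cg), whence the second factor and the power
   [l ^+ size y] in [EF]. *)
pose F v := lpert (fun a => v a 0) (g v) x * lpert (cf v) (fun a => cf v a - cg v a) y.
have nlin (f h : borelC R d -> R[i]) : nice f -> nice h ->
    nicep (fun v => (f v)%:P + ('X - 1) * (h v)%:P).
  move=> nf nh; apply: nicepD; first exact: nicep_cst.
  apply: nicepM; last exact: nicep_cst.
  apply: nicepD; first exact: nicep_X.
  rewrite (_ : (fun=> _) = fun=> (-1)%:P); first by apply: nicep_cst; exact: nice_cst.
  by apply/funext => v; rewrite polyCN.
have nN (f : borelC R d -> R[i]) : nice f -> nice (fun v => - f v).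
  move=> nf; rewrite (_ : (fun _ => _) = fun v => -1 * f v).
    by apply: niceM => //; exact: nice_cst.
  by apply/funext => v; rewrite mulN1r.
have nF : nicep F.
  apply: nicepM; apply: nicep_prod => a; apply: nlin => //.
    exact: nice_coord.
  by apply: niceD => //; exact: nN.
have FE v : (F v)^`().[1] =
    (lder (fun a => v a 0) (g v) x * (mono y v)^*%C
     + (size y)%:R * (mono x v * (mono y v)^*%C))
    + (-1) * (mono x v * (lder (fun a => v a 0) (g v) y)^*%C).
  rewrite derivM hornerD !hornerM !lpert_deriv1 !lpert_horner subrr.
  under eq_bigr do rewrite mul0r addr0.
  under [in X in _ + X]eq_bigr do rewrite mul0r addr0.
  rewrite lder_sub conj_lder /mono rmorph_prod /=; ring.
have EF l : l^*%C * l = 1 -> Ex mu (fun v => (F v).[l])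
    = l ^+ size y * Ex mu (fun v => mono x v * (mono y v)^*%C).
  move=> l1; have nxy : nice (fun v => mono x v * (mono y v)^*%C).
    by apply: niceM; [|apply: nice_conj]; exact: nice_mono.
  have FU v : (F v).[l] = l ^+ size y *
     (mono x (phase_mx u l *m v) * (mono y (phase_mx u l *m v))^*%C).
    rewrite hornerM !lpert_horner mulrCA; congr (_ * _).
      by apply: eq_bigr => a _; rewrite phase_mxE.
    rewrite /mono rmorph_prod /=; elim: y {F FE nF nxy} => [|a y IH].
      by rewrite !big_nil mulr1.
    rewrite !big_cons IH exprS mulrACA; congr (_ * _).
    rewrite phase_mxE rmorphD rmorphM rmorphB rmorph1 /= -/(g v a).
    have -> : cf v a = l^*%C * l * cf v a by rewrite l1 mul1r.
    rewrite /cf /cg; ring: l1.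
  rewrite (_ : (fun _ => _) = fun v => l ^+ size y *
     (mono x (phase_mx u l *m v) * (mono y (phase_mx u l *m v))^*%C)); last exact/funext.
  have nU : nice (fun v : borelC R d =>
      mono x (phase_mx u l *m v) * (mono y (phase_mx u l *m v))^*%C).
    have nUa a : nice (fun v : borelC R d => (phase_mx u l *m v) a 0).
      rewrite (_ : (fun _ => _) = fun v => v a 0 + (l - 1) * g v a).
        apply: niceD; first exact: nice_coord.
        by apply: niceM => //; exact: nice_cst.
      by apply/funext => v; rewrite phase_mxE.
    by apply: niceM; [|apply: nice_conj]; exact: nice_prod.
  rewrite ExZ//; congr (_ * _).
  exact: (Ex_unitary umu (phase_mx_unitary u0 l1) nxy nU).
have := Ex_horner_deriv smu nF EF.
rewrite (_ : (fun v => _) = fun v => (lder (fun a => v a 0) (g v) x * (mono y v)^*%C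
     + (size y)%:R * (mono x v * (mono y v)^*%C))
    + (-1) * (mono x v * (lder (fun a => v a 0) (g v) y)^*%C)); last exact/funext.
have nl z : nice (fun v => lder (fun a => v a 0) (g v) z).
  by apply: (nice_lder (f := fun a v => v a 0) (g := fun a v => g v a)) => // a; exact: nice_coord.
have n1 : nice (fun v => lder (fun a => v a 0) (g v) x * (mono y v)^*%C).
  by apply: niceM => //; apply: nice_conj; exact: nice_mono.
have n2 : nice (fun v => mono x v * (mono y v)^*%C).
  by apply: niceM; [|apply: nice_conj]; exact: nice_mono.
have n3 : nice (fun v => mono x v * (lder (fun a => v a 0) (g v) y)^*%C).
  by apply: niceM; [exact: nice_mono|exact: nice_conj].
have nk c f : nice f -> nice (fun v : borelC R d => c * f v).
  by move=> nf; apply: niceM => //; exact: nice_cst.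
rewrite !ExD ?ExZ //; [|exact: nk|exact: niceD (nk _ _ _)|exact: nk].
(* The terms in [size y] cancel: one comes from [lder_sub], the other from differentiating
   [l ^+ size y] at 1. *)
by move=> E; apply/eqP; rewrite -subr_eq0; apply/eqP; move/eqP: E;
  rewrite -subr_eq0 mulN1r => /eqP <-; ring.
Qed.

End IntegrationByParts.

Lemma sum_delta (K : nzRingType) (d : nat) (p q : 'I_d) (w : K) (F : 'I_d -> K) :
  \sum_b ((b == p)%:R + w * (b == q)%:R) * F b = F p + w * F q.
Proof.
under eq_bigr do rewrite mulrDl -mulrA.
rewrite big_split -mulr_sumr /=; congr (_ + _ * _).
  by rewrite (bigD1 p)//= eqxx mul1r big1 ?addr0// => b /negPf->; rewrite mul0r.
by rewrite (bigD1 q)//= eqxx mul1r big1 ?addr0// => b /negPf->; rewrite mul0r.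
Qed.

(** Polarization along e_p + w e_q: w = 0 and w = 1, -1 kill the diagonal entries, then w = 1 and w
    = i separate [H p q] from [H q p]. *)
Lemma hermitian_form_eq0 (R : realType) (d : nat) (H : 'I_d -> 'I_d -> R[i]) :
  (forall u : 'cV[R[i]]_d, \sum_b \sum_c u b 0 * (u c 0)^*%C * H b c = 0) ->
  forall b c, H b c = 0.
Proof.
move=> H0 p q; have E w : H p p + w^*%C * H p q + w * (H q p + w^*%C * H q q) = 0.
  rewrite -[RHS](H0 (\col_a ((a == p)%:R + w * (a == q)%:R))).
  rewrite -(sum_delta p q w (fun b => H b p + w^*%C * H b q)).
  apply: eq_bigr => b _; rewrite -(sum_delta p q w^*%C (H b)) mulr_sumr.
  apply: eq_bigr => c _; rewrite !mxE rmorphD rmorphM /= !conjc_nat; ring.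
have pp : H p p = 0 by have := E 0; rewrite conjc0 !mul0r !addr0.
have e1 := E 1; have ei := E 'i%C; have eN := E (-1).
have cN : (- 1 : R[i])^*%C = - 1 by rewrite rmorphN; congr (- _); exact: conjc1.
rewrite conjc1 in e1; rewrite cN in eN.
have qq : H q q = 0.
  have : 2%:R * H q q = 0.
    transitivity (H p p + 1 * H p q + 1 * (H q p + 1 * H q q) +
      (H p p + -1 * H p q + -1 * (H q p + -1 * H q q)) - 2%:R * H p p); first by ring.
    by rewrite e1 eN pp mulr0 addr0 subr0.
  by move/eqP; rewrite mulf_eq0 pnatr_eq0 => /eqP.
rewrite pp qq in e1 ei.
have ci : ('i%C)^*%C = - 'i%C :> R[i] by simpc.
have ii : 'i%C * 'i%C = -1 :> R[i] by rewrite -expr2 sqr_i.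
have : 2%:R * H p q = 0.
  have e : (1 + 'i%C * 'i%C) * H q p = 0 by rewrite ii subrr mul0r.
  rewrite ci in ei.
  transitivity ('i%C * (0 + - 'i%C * H p q + 'i%C * (H q p + - 'i%C * 0)) +
    (0 + 1 * H p q + 1 * (H q p + 1 * 0))); last by rewrite ei e1 mulr0 addr0.
  by ring: ii.
by move/eqP; rewrite mulf_eq0 pnatr_eq0 => /eqP.
Qed.

(** * Moments of the uniform distribution *)

Section HaarMoments.
Context {R : realType} {d : nat} (mu : probability (borelC R d) R).
Context (umu : uniform_state_distribution mu).
Let smu : state_distribution mu := umu.1.
Implicit Types (x y z : seq 'I_d) (v : borelC R d).
Local Notation mono := (@mono R d).
Local Notation dmono := (@dmono R d).

(* The generators [|u><u|] span all matrices over the complex numbers, hence the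
   first-order invariance extends to the elementary matrices. *)
Lemma Ex_lder_elem x y b c :
  Ex mu (fun v => v c 0 * dmono b x v * (mono y v)^*%C) =
  Ex mu (fun v => mono x v * (v b 0 * dmono c y v)^*%C).
Proof.
apply/eqP; rewrite -subr_eq0; apply/eqP.
pose H b c := Ex mu (fun v => v c 0 * dmono b x v * (mono y v)^*%C)
  - Ex mu (fun v => mono x v * (v b 0 * dmono c y v)^*%C).
have n1 b' c' : nice (fun v => v c' 0 * dmono b' x v * (mono y v)^*%C).
  apply: niceM; last by apply: nice_conj; exact: nice_mono.
  by apply: niceM; [exact: nice_coord|exact: nice_dmono].
have n2 b' c' : nice (fun v => mono x v * (v b' 0 * dmono c' y v)^*%C).
  apply: niceM; first exact: nice_mono.
  by apply: nice_conj; apply: niceM; [exact: nice_coord|exact: nice_dmono].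
apply: (@hermitian_form_eq0 _ _ H) => u.
(* The phase matrices need <u|u> nonzero; otherwise [u] vanishes and so does the form. *)
have [u0|u0] := eqVneq (braket u u) 0.
  suff u0' a : u a 0 = 0.
    by rewrite big1// => b' _; rewrite big1// => c' _; rewrite u0' !mul0r.
  have /complexI/eqP : (\sum_a Normc.normc (u a 0) ^+ 2)%:C = (0 : R)%:C.
    by rewrite -braket_norm u0.
  apply: contraTeq => ua; rewrite psumr_neq0 => [|i _]; last exact: sqr_ge0.
  apply/hasP; exists a; first exact: mem_index_enum.
  rewrite /= lt0r sqr_ge0 andbT sqrf_eq0.
  by apply: contraNN ua => /eqP/Normc.eq0_normc ->.
(* These are the entries of the projector onto the line of [u]. *)
pose k (bc : 'I_d * 'I_d) := u bc.1 0 * (u bc.2 0)^*%C / braket u u.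
have lderE z v : lder (fun a => v a 0) (fun a => u a 0 * braket u v / braket u u) z
    = \sum_bc k bc * (v bc.2 0 * dmono bc.1 z v).
  under eq_bigr do rewrite mulrA.
  rewrite -(lder_sum (fun a => v a 0) z _ (fun bc => k bc * v bc.2 0) (fun bc a => (a == bc.1)%:R)).
  congr lder; apply/funext => a.
  rewrite -(pair_bigA _ (fun b' c' => k (b', c') * v c' 0 * (a == b')%:R)) /=.
  rewrite (bigD1 a)//= [X in _ + X]big1 ?addr0; last first.
    by move=> b' /negPf; rewrite eq_sym => ->; rewrite big1// => c' _; rewrite mulr0.
  rewrite braketE mulr_sumr mulr_suml; apply: eq_bigr => c' _.
  rewrite eqxx /k /=; ring.
have E : Ex mu (fun v => \sum_bc k bc * (v bc.2 0 * dmono bc.1 x v * (mono y v)^*%C))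
    = Ex mu (fun v => \sum_bc k bc * (mono x v * (v bc.1 0 * dmono bc.2 y v)^*%C)).
  apply: (etrans (etrans _ (Ex_lder_braket umu x y u0))); congr Ex; apply/funext => v.
    by rewrite lderE mulr_suml; apply: eq_bigr => bc _; rewrite !mulrA.
  rewrite lderE rmorph_sum mulr_sumr.
  (* The projector is Hermitian: conjugating [k] swaps its two indices. *)
  rewrite (reindex_inj (h := fun bc : 'I_d * 'I_d => (bc.2, bc.1))) /=; last first.
    by move=> [? ?] [? ?] [-> ->].
  apply: eq_bigr => bc _; rewrite rmorphM mulrCA; congr (_ * _).
  rewrite /k !rmorphM fmorphV /=.
  have -> : (braket u u)^*%C = braket u u := conj_braket u u.
  by congr (_ / _); rewrite conjcK mulrC.
move: E; rewrite !Ex_sum => // [E|bc|bc]; last 2 first.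
- by apply: niceM => //; exact: nice_cst.
- by apply: niceM => //; exact: nice_cst.
rewrite pair_bigA /=; apply: (mulIf (invr_neq0 u0)).
rewrite mul0r mulr_suml.
transitivity (\sum_bc k bc * H bc.1 bc.2).
  by apply: eq_bigr => bc _; rewrite /k; ring.
move/eqP: E; rewrite -subr_eq0 -sumrB => /eqP E; rewrite -[RHS]E.
by apply: eq_bigr => bc _; rewrite !ExZ// -mulrBr.
Qed.

(** Euler's identity for homogeneous polynomials. *)
Lemma mono_euler x v : \sum_c v c 0 * dmono c x v = (size x)%:R * mono x v.
Proof.
elim: x => [|a x IH]; first by rewrite big1 ?mul0r// => c _; rewrite mulr0.
rewrite /mono big_cons -/(mono x v).
rewrite (eq_bigr (fun c => (a == c)%:R * (v c 0 * mono x v) +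
    v a 0 * (v c 0 * dmono c x v))); last by move=> c _; rewrite /dmono /= -/(mono x v); ring.
rewrite big_split -mulr_sumr IH /= (bigD1 a)//= eqxx mul1r big1 ?addr0; last first.
  by move=> c; rewrite eq_sym => /negPf->; rewrite mul0r.
by rewrite mulrS; ring.
Qed.

(* Multiplication by a coordinate is, up to the factor [d + size y], adjoint to the partial
   derivative: apply [Ex_lder_elem] to [c :: y] and sum over [c], using [<v|v> = 1]. *)
Lemma Ex_mono_adjoint x y b :
  (d + size y)%:R * Ex mu (fun v => mono x v * (mono (b :: y) v)^*%C) =
  Ex mu (fun v => dmono b x v * (mono y v)^*%C).
Proof.
have nm z : nice (mono z) by exact: nice_mono.
have nd c z : nice (dmono c z) by exact: nice_dmono.
have nc c : nice (fun v : borelC R d => v c 0) by exact: nice_coord.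
have E c := Ex_lder_elem x (c :: y) b c.
transitivity (\sum_c Ex mu (fun v => mono x v * (v b 0 * dmono c (c :: y) v)^*%C)).
  rewrite -(Ex_sum smu) => [|c]; last by apply: niceM => //; apply: nice_conj; exact: niceM.
  rewrite -(ExZ smu); last by apply: niceM => //; exact: nice_conj.
  congr Ex; apply/funext => v; rewrite -mulr_sumr mulrCA; congr (_ * _).
  rewrite -rmorph_sum -mulr_sumr /=.
  (* Differentiating the leading letter gives [mono y v] once for each of the [d] values of [c]; the
     other letters give [size y] copies by Euler's identity. *)
  have -> : \sum_c dmono c (c :: y) v = (d + size y)%:R * mono y v.
    rewrite natrD mulrDl -mono_euler.
    under eq_bigr do rewrite /dmono /= eqxx mul1r.
    by rewrite big_split sumr_const card_ord /= mulr_natl.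
  rewrite mulrCA [LHS](_ : _ = ((d + size y)%:R * (v b 0 * mono y v))^*%C) //.
  by rewrite [RHS]rmorphM /= conjc_nat /mono big_cons.
rewrite -(eq_bigr _ (fun c _ => E c)) -(Ex_sum smu); last first.
  by move=> c; apply: niceM; [exact: niceM|exact: nice_conj].
apply: (eq_Ex smu) => //.
- apply: nice_sum => c; apply: niceM; [exact: niceM|exact: nice_conj].
- by apply: niceM => //; exact: nice_conj.
move=> v uv; transitivity (braket v v * (dmono b x v * (mono y v)^*%C)).
  rewrite braketE mulr_suml; apply: eq_bigr => c _.
  by rewrite /mono big_cons rmorphM /=; ring.
by rewrite uv mul1r.
Qed.

Let G x y := Ex mu (fun v => mono x v * (mono y v)^*%C).

(** The product rule one letter at a time: [z] collects the letters already passed undifferentiated,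
    which lets the next two results induct on the word still to be differentiated. *)
Lemma Ex_dmono_cons z b a x y :
  Ex mu (fun v => mono z v * dmono b (a :: x) v * (mono y v)^*%C) =
  (a == b)%:R * G (z ++ x) y +
  Ex mu (fun v => mono (rcons z a) v * dmono b x v * (mono y v)^*%C).
Proof.
have nm w : nice (mono w) by exact: nice_mono.
have nd c w : nice (dmono c w) by exact: nice_dmono.
have nG w : nice (fun v => mono w v * (mono y v)^*%C).
  by apply: niceM => //; exact: nice_conj.
rewrite -ExZ// -ExD//; last 2 first.
- by apply: niceM => //; exact: nice_cst.
- by apply: niceM; [exact: niceM|exact: nice_conj].
congr Ex; apply/funext => v; rewrite /mono big_cat big_rcons /= /dmono /=.
by rewrite -/(mono x v) -/(dmono b x v); ring.
Qed.

(** Adjointness moves the letter [b] of the second word to a derivative on the first; this leaves a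
    sum of moments of lower degree with coefficients 0 or 1. *)
Lemma Ex_mono_ge0 x y : size x = size y -> 0 <= G x y.
Proof.
elim: y x => [|b y IH] x.
  move=> /size0nil ->; rewrite /G (_ : (fun _ => _) = fun=> 1) ?Ex_cst ?ler01//.
  by apply/funext => v; rewrite /mono !big_nil conjc1 mulr1.
move=> sx; have d0 : (0 < d + size y)%N by rewrite addn_gt0 (leq_ltn_trans _ (ltn_ord b)).
rewrite -(pmulr_rge0 _ (_ : 0 < (d + size y)%:R)) ?ltr0n// Ex_mono_adjoint.
suff H z x' : (size z + size x' = (size y).+1)%N ->
    0 <= Ex mu (fun v => mono z v * dmono b x' v * (mono y v)^*%C).
  rewrite [leRHS](_ : _ = Ex mu (fun v => mono [::] v * dmono b x v * (mono y v)^*%C)).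
    exact: H.
  by congr Ex; apply/funext => v; rewrite /mono big_nil mul1r.
elim: x' z => [|a x' IHx] z.
  move=> _; rewrite (_ : (fun _ => _) = fun=> 0) ?Ex_cst//.
  by apply/funext => v; rewrite /dmono /= mulr0 mul0r.
move=> szx; rewrite Ex_dmono_cons addr_ge0//.
  by rewrite mulr_ge0// IH// size_cat; move: szx; rewrite addnS => -[].
by apply: IHx; rewrite size_rcons addSn -addnS.
Qed.

Fixpoint words (k : nat) : seq (seq 'I_d) :=
  if k is k'.+1 then [seq b :: y | b <- enum 'I_d, y <- words k'] else [:: [::]].

Lemma sum_wordsS (K : nmodType) k (F : seq 'I_d -> K) :
  \sum_(w <- words k.+1) F w = \sum_b \sum_(w <- words k) F (b :: w).
Proof. by rewrite big_allpairs_dep big_enum. Qed.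

Lemma size_words k y : y \in words k -> size y = k.
Proof.
elim: k y => [|k IH] y /=; first by rewrite inE => /eqP ->.
by case/allpairsP => -[b z] /= [_ /IH <- ->].
Qed.

(** Summed over [b], the derivative removes each of the [k.+1] letters of [x] exactly once, so
    raising the degree multiplies the row sum by (k + 1) / (d + k), the inverse ratio of consecutive
    binomials. *)
Lemma Ex_mono_row_sum x k : (0 < d)%N -> size x = k ->
  \sum_(y <- words k) G x y = ('C(k + d - 1, d - 1))%:R^-1.
Proof.
move=> d0; elim: k x => [|k IH] x sx.
  move: sx => /size0nil ->; rewrite big_seq1 add0n binn invr1.
  rewrite /G (_ : (fun _ => _) = fun=> 1) ?Ex_cst//.
  by apply/funext => v; rewrite /mono !big_nil conjc1 mulr1.
have dk0 : (d + k)%:R != 0 :> R[i] by rewrite pnatr_eq0 addn_eq0 negb_and -lt0n d0.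
apply: (mulfI dk0); set c := _^-1 in IH *.
rewrite sum_wordsS mulr_sumr.
transitivity (k.+1%:R * ('C(k + d - 1, d - 1))%:R^-1 : R[i]); last first.
  have bin_neq0 j : ('C(j + d - 1, d - 1))%:R != 0 :> R[i].
    by rewrite pnatr_eq0 -lt0n bin_gt0 leq_sub2r// leq_addl.
  apply: (mulIf (bin_neq0 k)); rewrite mulfVK// mulrAC; apply: (mulIf (bin_neq0 k.+1)).
  rewrite mulfVK// -!natrM; congr _%:R.
  case: d d0 => // d' _; rewrite !addnS !subn1 /= addSn.
  have := mul_bin_down (k + d').+1 d'; rewrite subSn ?leq_addl// addnK => <-.
  by rewrite addSn [(d' + k)%N]addnC.
have H z x' : (size z + size x' = k.+1)%N ->
    \sum_(b : 'I_d) \sum_(y <- words k)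
      Ex mu (fun v => mono z v * dmono b x' v * (mono y v)^*%C)
    = (size x')%:R * ('C(k + d - 1, d - 1))%:R^-1.
  elim: x' z => [|a x' IHx] z szx.
    rewrite mul0r big1// => b _; rewrite big1// => y _.
    rewrite (_ : (fun _ => _) = fun=> 0) ?Ex_cst//.
    by apply/funext => v; rewrite /dmono /= mulr0 mul0r.
  under eq_bigr do under eq_bigr do rewrite Ex_dmono_cons.
  under eq_bigr do rewrite big_split -mulr_sumr /=.
  rewrite big_split /= IHx ?size_rcons ?addSn -?addnS// mulrS mulrDl mul1r.
  congr (_ + _); rewrite (bigD1 a)//= eqxx mul1r IH; last first.
    by rewrite size_cat; move: szx; rewrite addnS => -[].
  rewrite big1 ?addr0// => b /negPf; rewrite eq_sym => ->; exact: mul0r.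
rewrite -sx -(H [::] x)//; apply: eq_bigr => b _.
rewrite mulr_sumr !big_seq; apply: eq_bigr => y /size_words sy.
rewrite -sy Ex_mono_adjoint; congr Ex; apply/funext => v.
by rewrite /mono big_nil mul1r.
Qed.

End HaarMoments.

(** Lagrange's identity writes twice the gap as a sum of squares over pairs. *)
Lemma sum_cauchy_schwarz (R : realFieldType) (I : finType) (f g : I -> R) :
  (\sum_i f i * g i) ^+ 2 <= (\sum_i f i ^+ 2) * (\sum_i g i ^+ 2).
Proof.
rewrite -(ler_pM2l (ltr0n R 2)) -subr_ge0.
suff -> : 2 * ((\sum_i f i ^+ 2) * (\sum_i g i ^+ 2)) - 2 * (\sum_i f i * g i) ^+ 2
    = \sum_i \sum_j (f i * g j - f j * g i) ^+ 2.
  by apply: sumr_ge0 => i _; apply: sumr_ge0 => j _; exact: sqr_ge0.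
set A := \sum_i f i ^+ 2; set B := \sum_i f i * g i; set C := \sum_i g i ^+ 2.
transitivity (\sum_i (f i ^+ 2 * C + A * g i ^+ 2 - 2 * (f i * g i) * B)).
  rewrite sumrB big_split /= -!mulr_suml -!mulr_sumr -/A -/B -/C; ring.
apply: eq_bigr => i _; rewrite /A /B /C !mulr_sumr mulr_suml -big_split -sumrB.
by apply: eq_bigr => j _ /=; ring.
Qed.

Lemma normc_sum (R : rcfType) I (r : seq I) (P : pred I) (F : I -> R[i]) :
  Normc.normc (\sum_(i <- r | P i) F i) <= \sum_(i <- r | P i) Normc.normc (F i).
Proof.
elim/big_rec2: _ => [|i y z _ yz]; first by rewrite Normc.normc0.
by rewrite (le_trans (le_normcD _ _))// lerD2l.
Qed.

Lemma normc_conj (R : rcfType) (z : R[i]) : Normc.normc z^*%C = Normc.normc z.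
Proof. by case: z => a b /=; rewrite sqrrN. Qed.

Lemma normcX (R : rcfType) (z : R[i]) k : Normc.normc (z ^+ k) = Normc.normc z ^+ k.
Proof.
elim: k => [|k IH]; first by rewrite !expr0 Normc.normc1.
by rewrite !exprS Normc.normcM IH.
Qed.

(** * Product states and type classes *)

Section Decoding.
Context {R : realType} {d : nat}.

(* The base-[d] digits of an index of a [k.+1]-fold tensor power. *)
Fixpoint word_of k : 'I_(d ^ k.+1) -> seq 'I_d :=
  if k is k'.+1 return 'I_(d ^ k.+1) -> seq 'I_d then
    fun i => (mxtens_unindex i).1 :: word_of (mxtens_unindex i).2
  else fun i => [:: i].

Lemma size_word_of k (i : 'I_(d ^ k.+1)) : size (word_of i) = k.+1.
Proof. by elim: k i => //= k IH i; rewrite IH. Qed.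

Lemma sum_word_of (K : nmodType) k (F : seq 'I_d -> K) :
  \sum_(i < d ^ k.+1) F (word_of i) = \sum_(w <- @words d k.+1) F w.
Proof.
elim: k F => [|k IH] F.
  rewrite sum_wordsS.
  by apply: eq_bigr => b _; rewrite big_seq1.
rewrite sum_wordsS.
under [RHS]eq_bigr do rewrite -(IH (fun w => F (_ :: w))).
rewrite pair_bigA /= (reindex (@mxtens_unindex d (d ^ k.+1))) //=.
by exists (@mxtens_index d (d ^ k.+1)) => i _; rewrite (mxtens_indexK, mxtens_unindexK).
Qed.

Lemma sum_words_prod (K : comNzRingType) k (f : 'I_d -> K) :
  \sum_(w <- @words d k) \prod_(a <- w) f a = (\sum_a f a) ^+ k.
Proof.
elim: k => [|k IH]; first by rewrite big_seq1 big_nil.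
rewrite sum_wordsS exprS -IH mulr_suml.
by apply: eq_bigr => b _; rewrite mulr_sumr; apply: eq_bigr => w _; rewrite big_cons.
Qed.

Lemma ntensmx_outer (v : 'cV[R[i]]_d) k (x y : 'I_(d ^ k.+1)) :
  ntensmx (v *m v ^t* ) k.+1 x y = mono (word_of x) v * (mono (word_of y) v)^*%C.
Proof.
rewrite /ntensmx; elim: k x y => [|k IH] x y.
  by rewrite /mono /= !big_seq1 mxE big_ord1 !mxE.
rewrite /= mxE IH /mono !big_cons rmorphM /= mxE big_ord1 !mxE; ring.
Qed.

End Decoding.

Section Qubits.
Context {R : realType}.

(** Binary digits in the order of the tensor factors; positions past the last qubit repeat the last
    digit. *)
Fixpoint qubit n : 'I_(2 ^ n.+1) -> nat -> 'I_2 :=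
  if n is n'.+1 return 'I_(2 ^ n.+1) -> nat -> 'I_2 then
    fun i j => if j is j'.+1 then qubit (mxtens_unindex i).2 j' else (mxtens_unindex i).1
  else fun i _ => i.

Lemma tensvE (a : nat -> 'cV[R[i]]_2) n (i : 'I_(2 ^ n.+1)) :
  tensv a n.+1 i 0 = \prod_(j < n.+1) a j (qubit i j) 0.
Proof.
rewrite /tensv; elim: n a i => [|n IH] a i; first by rewrite big_ord1.
by rewrite /= mxE !ord1 IH [RHS]big_ord_recl.
Qed.

Lemma prod_ord2 (K : comNzRingType) I (s : seq I) (b : I -> 'I_2) (f : 'I_2 -> K) :
  \prod_(i <- s) f (b i) = f 0 ^+ (size s - count (fun i => b i == 1) s)
    * f 1 ^+ count (fun i => b i == 1) s.
Proof.
elim: s => [|i s IH]; first by rewrite big_nil mulr1.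
rewrite big_cons IH /=; have [->|b1] := eqVneq (b i) 1.
  by rewrite !add1n subSS exprS mulrCA.
have -> : b i = 0 by case: (b i) b1 => -[|[|m]] m2 //= ?; apply/val_inj.
by rewrite !add0n subSn ?count_size// exprS mulrA.
Qed.

Context {n k : nat}.
Implicit Types X Y : 'I_((2 ^ n.+1) ^ k.+1).

(* The type of a computational basis index of [k.+1] copies: how many of the copies of each
   qubit are in the state 1. *)
Definition weights X : {ffun 'I_n.+1 -> 'I_k.+2} :=
  [ffun j => inord (count (fun i => qubit i (j : 'I_n.+1) == 1) (word_of X))].

(** After exchanging the products over copies and over qubits, the factor of each qubit depends only
    on how many copies carry a 1. *)
Lemma mono_tensv_weights (a : nat -> 'cV[R[i]]_2) X Y : weights X = weights Y ->
  mono (word_of X) (tensv a n.+1) = mono (word_of Y) (tensv a n.+1).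
Proof.
move=> XY; rewrite /mono.
under eq_bigr do rewrite tensvE; under [RHS]eq_bigr do rewrite tensvE.
rewrite exchange_big [RHS]exchange_big /=; apply: eq_bigr => j _.
rewrite !(prod_ord2 _ (fun i => qubit i j) (fun e => a j e 0)) !size_word_of.
have := congr1 (fun w : {ffun _ -> _} => nat_of_ord (w j)) XY; rewrite !ffunE !inordK => [->//||];
  by rewrite ltnS (leq_trans (count_size _ _))// size_word_of.
Qed.

Definition class_sum (v : 'cV[R[i]]_(2 ^ n.+1)) (t : {ffun 'I_n.+1 -> 'I_k.+2}) : R[i] :=
  \sum_(X | weights X == t) mono (word_of X) v.

(** The right-hand side of the overlap bound. It does not depend on the product state, hence no
    union bound is required. *)
Definition class_energy (v : 'cV[R[i]]_(2 ^ n.+1)) : R :=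
  \sum_t (#|[pred X | weights X == t]|%:R)^-1 * Normc.normc (class_sum v t) ^+ 2.

Lemma braketX (d : nat) (u v : 'cV[R[i]]_d) (m : nat) :
  braket u v ^+ m.+1 = \sum_(X < d ^ m.+1) (mono (word_of X) u)^*%C * mono (word_of X) v.
Proof.
rewrite braketE -sum_words_prod -(sum_word_of _ (fun w => \prod_(a <- w) _)).
by apply: eq_bigr => X _; rewrite /mono rmorph_prod -big_split.
Qed.

(* The entries of [alpha^(x)k] depend only on the type of the index; group the terms of
   [<alpha^(x)k|v^(x)k>] by type and apply the Cauchy-Schwarz inequality. *)
Lemma product_overlap_le (a : nat -> 'cV[R[i]]_2) v : unit_vec (tensv a n.+1) ->
  (Normc.normc (braket (tensv a n.+1) v) ^+ 2) ^+ k.+1 <= class_energy v.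
Proof.
move=> ua; set al := tensv a n.+1 in ua *.
have al1 : \sum_(X < (2 ^ n.+1) ^ k.+1) Normc.normc (mono (word_of X) al) ^+ 2 = 1.
  have ua1 : braket al al = 1 := ua.
  apply: complexI; rewrite rmorph_sum.
  rewrite [RHS](_ : _ = braket al al ^+ k.+1); last by rewrite ua1 expr1n.
  rewrite braketX.
  by apply: eq_bigr => X _; rewrite mulJc.
rewrite exprAC -normcX braketX.
(* The common entry of the tensor power of [al] on the class [t], with default 0 on an empty
   class. *)
pose g t := if [pick X | weights X == t] is Some X then mono (word_of X) al else 0.
have gE X : mono (word_of X) al = g (weights X).
  rewrite /g; case: pickP => [Y /eqP /esym|/(_ X)]; last by rewrite eqxx.
  exact: mono_tensv_weights.
pose N t := #|[pred X : 'I_((2 ^ n.+1) ^ k.+1) | weights X == t]|.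
rewrite (partition_big weights xpredT)//=.
have -> : \sum_t \sum_(X | weights X == t) (mono (word_of X) al)^*%C * mono (word_of X) v
    = \sum_t (g t)^*%C * class_sum v t.
  apply: eq_bigr => t _; rewrite mulr_sumr; apply: eq_bigr => X /eqP <-.
  by rewrite gE.
apply: (@le_trans _ _ ((\sum_t Normc.normc (g t) * Normc.normc (class_sum v t)) ^+ 2)).
  rewrite ler_sqr ?nnegrE ?normc_ge0//; last first.
    by apply: sumr_ge0 => t _; rewrite mulr_ge0 ?normc_ge0.
  rewrite (le_trans (normc_sum _ _ _))//; apply: ler_sum => t _.
  by rewrite Normc.normcM normc_conj.
(* The square root of the class size is split off so that the squares of the first factors sum to
   the squared norm of the tensor power of [al], which is 1. *)
have -> : \sum_t Normc.normc (g t) * Normc.normc (class_sum v t) =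
    \sum_t (Num.sqrt (N t)%:R * Normc.normc (g t)) *
           ((Num.sqrt (N t)%:R)^-1 * Normc.normc (class_sum v t)).
  apply: eq_bigr => t _; have [t0|t0] := eqVneq (N t) 0%N.
    rewrite /class_sum big_pred0 ?Normc.normc0 ?mulr0// => X.
    by have /card0_eq/(_ X) := t0.
  have s0 : Num.sqrt (N t)%:R != 0 :> R by rewrite sqrtr_eq0 -ltNge ltr0n lt0n.
  by field.
rewrite (le_trans (sum_cauchy_schwarz _ _))//.
have -> : \sum_t (Num.sqrt (N t)%:R * Normc.normc (g t)) ^+ 2 = 1.
  rewrite -[RHS]al1 [RHS](partition_big weights xpredT)//=; apply: eq_bigr => t _.
  rewrite exprMn sqr_sqrtr ?ler0n//  mulr_natl -sumr_const; apply: eq_big => X //.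
  by rewrite inE => /eqP <-; rewrite gE.
rewrite mul1r; apply: ler_sum => t _.
by rewrite exprMn exprVn sqr_sqrtr ?ler0n.
Qed.

End Qubits.

(** * Designs *)

Section OperatorNorm.
Context {R : realType} {d : nat}.
Implicit Types (u v : 'cV[R[i]]_d) (D : 'M[R[i]]_d) (P : pred 'I_d).

Lemma vnormE v : vnorm v = Num.sqrt (\sum_a Normc.normc (v a 0) ^+ 2).
Proof. by rewrite /vnorm braket_norm. Qed.

Lemma vnorm_unit v : unit_vec v -> vnorm v = 1.
Proof. by move/unit_vecP => v1; rewrite vnormE v1 sqrtr1. Qed.

Lemma normc_braket_le u v : Normc.normc (braket u v) <= vnorm u * vnorm v.
Proof.
have s0 w : 0 <= \sum_a Normc.normc (w a 0) ^+ 2 :> R.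
  by apply: sumr_ge0 => a _; exact: sqr_ge0.
rewrite -(@ler_pXn2r _ 2) ?nnegrE ?normc_ge0 ?mulr_ge0 ?sqrtr_ge0//.
rewrite exprMn !vnormE !sqr_sqrtr ?s0//; apply: le_trans (sum_cauchy_schwarz _ _).
rewrite ler_pXn2r ?nnegrE ?normc_ge0//; last first.
  by apply: sumr_ge0 => a _; rewrite mulr_ge0 ?normc_ge0.
rewrite braketE (le_trans (normc_sum _ _ _))//.
by apply: ler_sum => a _; rewrite Normc.normcM normc_conj.
Qed.

Lemma vnorm_le_sum v : vnorm v <= \sum_a Normc.normc (v a 0).
Proof.
have s0 : 0 <= \sum_a Normc.normc (v a 0) by apply: sumr_ge0 => a _; exact: normc_ge0.
rewrite vnormE -[leRHS]ger0_norm// -sqrtr_sqr ler_wsqrtr// [leRHS]expr2 mulr_suml.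
apply: ler_sum => a _; rewrite expr2 ler_wpM2l ?normc_ge0// (bigD1 a)//= lerDl.
by apply: sumr_ge0 => b _; exact: normc_ge0.
Qed.

(** The supremum is genuine: coordinates of unit vectors have modulus at most 1, so the sum of the
    moduli of the entries of [D] is a bound. *)
Lemma opnorm_ub D v : unit_vec v -> vnorm (D *m v) <= opnorm D.
Proof.
move=> uv; apply: ub_le_sup; last by exists v.
exists (\sum_a \sum_b Normc.normc (D a b)) => _ [w uw <-].
rewrite (le_trans (vnorm_le_sum _))//; apply: ler_sum => a _.
rewrite mxE (le_trans (normc_sum _ _ _))//; apply: ler_sum => b _.
by rewrite Normc.normcM ler_piMr ?normc_ge0 ?unit_coord_le1.
Qed.

Lemma opnorm_ge0 D : 0 <= opnorm D.
Proof.
have [[v uv]|nv] := pselect (exists v : 'cV[R[i]]_d, unit_vec v).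
  by rewrite (le_trans _ (opnorm_ub D uv))// sqrtr_ge0.
rewrite /opnorm (_ : [set _ | _ in _] = set0) ?sup0//.
apply/seteqP; split => // w [v uv _].
by apply: nv; exists v.
Qed.

(** The block sum is #|P| times <v|Dv> for the normalized indicator vector v of [P]. *)
Lemma block_sum_le D P :
  Normc.normc (\sum_(x | P x) \sum_(y | P y) D x y) <= #|P|%:R * opnorm D.
Proof.
have [P0|P0] := eqVneq #|P| 0%N.
  rewrite big_pred0 => [|x]; last exact: (card0_eq P0 x).
  by rewrite Normc.normc0 P0 mul0r.
have N0 : 0 < #|P|%:R :> R by rewrite ltr0n lt0n.
pose s := Num.sqrt (#|P|%:R : R); have s2 : s * s = #|P|%:R by rewrite -expr2 sqr_sqrtr.
have s0 : s != 0 by rewrite sqrtr_eq0 -ltNge.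
pose v : 'cV[R[i]]_d := \col_x ((P x)%:R * s^-1)%:C.
have uv : unit_vec v.
  apply/unit_vecP; transitivity (\sum_(x | P x) (#|P|%:R : R)^-1).
    rewrite [RHS]big_mkcond; apply: eq_bigr => x _; rewrite mxE /= expr0n addr0 sqrtr_sqr.
    rewrite real_normK ?num_real// -s2.
    by case: (P x); rewrite ?mul1r ?mul0r ?expr0n ?exprVn ?expr2.
  by rewrite sumr_const -[LHS]mulr_natl divff ?gt_eqF.
have := le_trans (normc_braket_le v (D *m v)) (ler_pM _ _ (lexx _) (opnorm_ub D uv)).
rewrite vnorm_unit// mul1r ler01 sqrtr_ge0 => /(_ isT isT).
rewrite -(ler_pM2l N0); apply: le_trans.
rewrite -[#|P|%:R]ger0_norm ?ler0n//.
have -> : `|#|P|%:R| = Normc.normc (#|P|%:R%:C : R[i]) by rewrite /= expr0n addr0 sqrtr_sqr.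
rewrite -Normc.normcM le_eqVlt; apply/orP; left; apply/eqP; congr Normc.normc.
rewrite braketE mulr_sumr [LHS]big_mkcond; apply: eq_bigr => x _.
rewrite !mxE conjc_real; case: (P x); last by rewrite !mul0r mulr0.
rewrite big_mkcond mulrA mulr_sumr; apply: eq_bigr => y _; rewrite mxE.
case: (P y); last by rewrite !mul0r !mulr0.
rewrite !mul1r.
have e : (#|P|%:R)%:C * (s^-1)%:C * (s^-1)%:C = 1 :> R[i].
  by rewrite -!rmorphM -s2 mulfK// divff.
by rewrite -[LHS]mul1r -e; ring.
Qed.

End OperatorNorm.

Lemma momentE (R : realType) (d : nat) (mu : probability (borelC R d) R) k x y :
  moment mu k.+1 x y = Ex mu (fun v => mono (word_of x) v * (mono (word_of y) v)^*%C).
Proof.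
rewrite mxE /Ex; congr (_ +i* _); apply: eq_Rintegral => v _;
  by rewrite ntensmx_outer.
Qed.

(** * Expected class energy under the uniform distribution and under a design *)

Section ClassEnergy.
Context {R : realType} {n k : nat}.
Local Notation d := (2 ^ n.+1)%N.
Implicit Types (mu nu : probability (borelC R d) R) (t : {ffun 'I_n.+1 -> 'I_k.+2}).

Definition class_sq t (v : borelC R d) : R[i] := class_sum v t * (class_sum v t)^*%C.

Lemma nice_class_sq t : nice (class_sq t).
Proof.
have H : nice (fun v : borelC R d => class_sum v t).
  rewrite (_ : (fun _ => _) = fun v => \sum_(X <- [seq X <- index_enum _ | weights X == t])
      mono (word_of X) v); first by apply: nice_sum => X; exact: nice_mono.
  by apply/funext => v; rewrite big_filter.
by apply: niceM => //; exact: nice_conj.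
Qed.

Lemma Ex_class_sq mu t : state_distribution mu ->
  Ex mu (class_sq t) = \sum_(X | weights X == t) \sum_(Y | weights Y == t) moment mu k.+1 X Y.
Proof.
move=> smu; have nm (X : 'I_(d ^ k.+1)) : nice (@mono R d (word_of X)) by exact: nice_mono.
have nG (X Y : 'I_(d ^ k.+1)) :
    nice (fun v => mono (word_of X) v * (@mono R d (word_of Y) v)^*%C).
  by apply: niceM => //; exact: nice_conj.
set r := [seq X <- index_enum _ | weights X == t].
rewrite (_ : class_sq t = fun v => \sum_(X <- r) \sum_(Y <- r)
    mono (word_of X) v * (mono (word_of Y) v)^*%C); last first.
  apply/funext => v; rewrite /class_sq /class_sum -big_filter rmorph_sum mulr_suml.
  by apply: eq_bigr => X _; rewrite mulr_sumr.
rewrite Ex_sum// => [|X]; last exact: nice_sum.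
rewrite -[RHS]big_filter -/r; apply: eq_bigr => X _; rewrite Ex_sum// -[RHS]big_filter.
by apply: eq_bigr => Y _; rewrite momentE.
Qed.

(** Moments are nonnegative, so each row of the block sums to at most the full row sum. *)
Lemma Ex_class_sq_uniform mu t : uniform_state_distribution mu ->
  Ex mu (class_sq t) <=
  #|[pred X : 'I_(d ^ k.+1) | weights X == t]|%:R / ('C(k.+1 + d - 1, d - 1))%:R.
Proof.
move=> umu; rewrite Ex_class_sq; last exact: umu.1.
rewrite mulr_natl -sumr_const; apply: ler_sum => X _.
rewrite -(Ex_mono_row_sum umu (expn_gt0 _ _) (size_word_of X)).
rewrite -(sum_word_of _ (fun w => Ex mu _)) big_mkcond; apply: ler_sum => Y _.
by case: ifP => _; rewrite ?momentE// Ex_mono_ge0// !size_word_of.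
Qed.

Lemma Re_Ex_class_sq_design (muH : probability (borelC R d) R) eps nu t :
  uniform_state_distribution muH -> approx_state_design muH k.+1 eps nu ->
  complex.Re (Ex nu (class_sq t)) <=
  #|[pred X : 'I_(d ^ k.+1) | weights X == t]|%:R *
    ((1 + eps) / ('C(k.+1 + d - 1, d - 1))%:R).
Proof.
move=> uH [snu eps_nu]; set N := #|_|%:R; set C := _%:R.
have -> : Ex nu (class_sq t) = Ex muH (class_sq t) +
    \sum_(X | weights X == t) \sum_(Y | weights Y == t)
      (moment nu k.+1 - moment muH k.+1) X Y.
  rewrite !Ex_class_sq//; last exact: uH.1.
  rewrite -big_split; apply: eq_bigr => X _; rewrite -big_split; apply: eq_bigr => Y _.
  by rewrite /= !mxE subrKC.
rewrite raddfD mulrDl mul1r mulrDr lerD//.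
  have := Ex_class_sq_uniform t uH.
  rewrite (_ : _ / _ = (N / C)%:C); last by rewrite rmorphM fmorphV !rmorph_nat.
  by rewrite lecE => /andP[_].
apply: (le_trans (ler_norm _)); apply: (le_trans (normr_Re_le _)).
by apply: (le_trans (block_sum_le _ _)); rewrite ler_wpM2l.
Qed.

Definition cclass_energy (v : borelC R d) : R[i] :=
  \sum_t ((#|[pred X : 'I_(d ^ k.+1) | weights X == t]|%:R)^-1)%:C * class_sq t v.

Lemma class_energyE (v : borelC R d) :
  @class_energy R n k v = complex.Re (cclass_energy v).
Proof.
rewrite /class_energy /cclass_energy raddf_sum; apply: eq_bigr => t _.
by rewrite /class_sq [class_sum v t * _]mulrC mulJc -rmorphM.
Qed.

Lemma nice_cclass_energy : nice cclass_energy.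
Proof.
by apply: nice_sum => t; apply: niceM; [exact: nice_cst|exact: nice_class_sq].
Qed.

(** The sign of [eps] follows from the design inequality, whose left side is a norm. *)
Lemma approx_design_eps_ge0 (muH : probability (borelC R d) R) eps nu :
  approx_state_design muH k.+1 eps nu -> 0 <= eps.
Proof.
move=> [_]; set C := 'C(_, _) => /(le_trans (opnorm_ge0 _)).
have C0 : 0 < C%:R :> R by rewrite ltr0n bin_gt0 leq_sub2r// leq_addl.
by rewrite pmulr_lge0 ?invr_gt0.
Qed.

(** The class size cancels, so each of the types contributes at most [B]. *)
Lemma integral_class_energy_le (muH : probability (borelC R d) R) eps nu :
  uniform_state_distribution muH -> approx_state_design muH k.+1 eps nu ->
  \int[nu]_v @class_energy R n k v <=
  ((k.+2) ^ n.+1)%:R * ((1 + eps) / ('C(k.+1 + d - 1, d - 1))%:R).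
Proof.
move=> uH dnu; have [snu _] := dnu; have eps0 := approx_design_eps_ge0 dnu.
set B := (1 + eps) / _; have B0 : 0 <= B by rewrite divr_ge0// addr_ge0.
have -> : \int[nu]_v @class_energy R n k v = complex.Re (Ex nu cclass_energy).
  by rewrite /Ex /=; apply: eq_Rintegral => v _; rewrite class_energyE.
rewrite Ex_sum// => [|t]; last first.
  by apply: niceM; [exact: nice_cst|exact: nice_class_sq].
have -> : ((k.+2) ^ n.+1)%:R * B = \sum_(t : {ffun 'I_n.+1 -> 'I_k.+2}) B.
  by rewrite sumr_const card_ffun !card_ord mulr_natl.
rewrite raddf_sum; apply: ler_sum => t _; rewrite ExZ//; last exact: nice_class_sq.
have := Re_Ex_class_sq_design t uH dnu; rewrite -/B; set N := #|_|%:R => H.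
apply: (@le_trans _ _ (N^-1 * complex.Re (Ex nu (class_sq t)))).
  by case: (Ex nu (class_sq t)) => a b /=; rewrite mul0r subr0.
have [N0|N0] := eqVneq N 0; first by rewrite N0 invr0 mul0r.
rewrite ler_pdivrMl//; by rewrite lt0r N0 /N ler0n.
Qed.

End ClassEnergy.

(** * The maximal overlap with product states *)

Section Overlap.
Context {R : realType} {n : nat}.
Local Notation d := (2 ^ n.+1)%N.
Implicit Types v : borelC R d.

Lemma unit_tensv (a : nat -> 'cV[R[i]]_2) : (forall j, unit_vec (a j)) ->
  unit_vec (tensv a n.+1).
Proof.
rewrite /tensv; elim: n a => [|m IH] a ua; first exact: ua.
apply/unit_vecP; rewrite /=.
have /unit_vecP a0 := ua 0%N.
have /unit_vecP aS := IH (fun i => a i.+1) (fun i => ua i.+1).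
transitivity (1 * 1 : R); last by rewrite mul1r.
rewrite -[X in X * _]a0 -aS mulr_sum; apply: eq_bigr => i _.
by rewrite mxE !ord1 Normc.normcM exprMn.
Qed.

Lemma qubit_inj m (z x : 'I_(2 ^ m.+1)) :
  (forall j, (j < m.+1)%N -> qubit z j = qubit x j) -> z = x.
Proof.
elim: m z x => [|m IH] z x zx; first exact: (zx 0%N).
rewrite -[z]mxtens_unindexK -[x]mxtens_unindexK.
have e1 : (mxtens_unindex z).1 = (mxtens_unindex x).1 := zx 0%N isT.
have e2 : (mxtens_unindex z).2 = (mxtens_unindex x).2.
  by apply: IH => j jm; have := zx j.+1 jm.
by congr mxtens_index; apply: injective_projections.
Qed.

Lemma unit_delta (p : nat) (x : 'I_p) : unit_vec (delta_mx x 0 : 'cV[R[i]]_p).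
Proof.
apply/unit_vecP; rewrite (bigD1 x)//= big1 => [|y yx]; rewrite !mxE.
  by rewrite !eqxx Normc.normc1 expr1n addr0.
by rewrite (negPf yx) Normc.normc0 expr0n.
Qed.

(** Makes the set of overlaps nonempty and the maximal overlap of a unit vector positive, which the
    logarithm in [Eg] requires. *)
Lemma basis_product_state (x : 'I_d) : product_state (delta_mx x 0 : 'cV[R[i]]_d).
Proof.
exists (fun j => delta_mx (qubit x j) 0) => [j|]; first exact: unit_delta.
apply/matrixP => i j; rewrite ord1 tensvE mxE eqxx andbT.
under eq_bigr do rewrite mxE eqxx andbT.
have [->|ix] := eqVneq i x; first by rewrite big1// => l _; rewrite eqxx.
have [l /negPf il|/= il] := pickP (fun l : 'I_n.+1 => qubit i l != qubit x l).
  by rewrite (bigD1 l)//= il mul0r.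
case/eqP: ix; apply: qubit_inj => l lm.
by have /negbFE/eqP := il (Ordinal lm).
Qed.

Definition overlaps v : set R :=
  [set Normc.normc (braket alpha v) ^+ 2 | alpha in @product_state R n.+1].

Lemma overlaps_ub v : ubound (overlaps v) (vnorm v ^+ 2).
Proof.
move=> _ [_ [a ua <-] <-]; rewrite ler_pXn2r ?nnegrE ?normc_ge0 ?sqrtr_ge0//.
rewrite (le_trans (normc_braket_le _ _))// vnorm_unit ?mul1r//; exact: unit_tensv.
Qed.

Lemma overlaps_has_sup v : has_sup (overlaps v).
Proof.
split; last by exists (vnorm v ^+ 2); exact: overlaps_ub.
have x : 'I_d by exists 0%N; rewrite expn_gt0.
by exists (Normc.normc (braket (delta_mx x 0) v) ^+ 2), (delta_mx x 0);
  first exact: basis_product_state.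
Qed.

Definition max_overlap v : R := sup (overlaps v).

Lemma max_overlap_le1 v : unit_vec v -> max_overlap v <= 1.
Proof.
move=> uv; apply: ge_sup; first exact: (overlaps_has_sup v).1.
by have := @overlaps_ub v; rewrite vnorm_unit// expr1n.
Qed.

Lemma max_overlap_gt0 v : unit_vec v -> 0 < max_overlap v.
Proof.
move=> uv; have [x vx|v0] := pickP (fun x : 'I_d => v x 0 != 0).
  have : 0 < Normc.normc (v x 0) ^+ 2.
    rewrite exprn_gt0// lt0r normc_ge0 andbT; apply: contraNN vx => /eqP.
    by move/Normc.eq0_normc ->.
  move=> /lt_le_trans; apply; apply: ub_le_sup; first exact: (overlaps_has_sup v).2.
  exists (delta_mx x 0); first exact: basis_product_state.
  congr (Normc.normc _ ^+ 2); rewrite braketE (bigD1 x)//= big1 => [|y yx].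
    by rewrite !mxE !eqxx conjc1 mul1r addr0.
  by rewrite !mxE (negPf yx) conjc0 mul0r.
move/unit_vecP: uv; rewrite big1 => [/esym/eqP|x _]; first by rewrite oner_eq0.
by have /negbFE/eqP -> := v0 x; rewrite Normc.normc0 expr0n.
Qed.

Lemma max_overlap_expn_le (k : nat) v : max_overlap v ^+ k.+1 <= @class_energy R n k v.
Proof.
have ce0 : 0 <= @class_energy R n k v.
  by apply: sumr_ge0 => t _; rewrite mulr_ge0 ?invr_ge0 ?ler0n ?sqr_ge0.
(* The overlap bound is turned into an upper bound [c] of the set itself, so that it passes to the
   supremum. *)
pose c := @class_energy R n k v `^ (k.+1%:R^-1).
have c0 : 0 <= c by exact: powR_ge0.
have ck : c ^+ k.+1 = @class_energy R n k v.
  by rewrite -powR_mulrn// -powRrM mulVf ?powRr1// pnatr_eq0.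
have m0 : 0 <= max_overlap v.
  have [[_ [a pa _]] b] := overlaps_has_sup v.
  by apply: (@le_trans _ _ (Normc.normc (braket a v) ^+ 2));
    [exact: sqr_ge0|apply: ub_le_sup => //; exists a].
rewrite -ck ler_pXn2r ?nnegrE//; apply: ge_sup; first exact: (overlaps_has_sup v).1.
move=> _ [_ [a ua <-] <-]; rewrite -(@ler_pXn2r _ k.+1) ?nnegrE ?sqr_ge0// ck.
by apply: product_overlap_le; exact: unit_tensv.
Qed.

(* The supremum of a family of continuous functions is lower semicontinuous. *)
Lemma measurable_max_overlap : measurable_fun setT max_overlap.
Proof.
apply: (measurability _ (RGenOInfty.measurableE R)).
move=> _ [_ [x ->] <-]; rewrite setTI; apply: sub_sigma_algebra.
(* The union is indexed by all product states; it is measurable because it is open. *)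
rewrite (_ : _ @^-1` _ = \bigcup_(alpha in @product_state R n.+1)
    [set v : 'cV[R[i]]_d | x < Normc.normc (braket alpha v) ^+ 2]); last first.
  apply/seteqP; split => v /=; rewrite in_itv /= andbT.
    by move=> /(sup_gt (overlaps_has_sup v).1)[_ [a pa <-] xa]; exists a.
  move=> [a pa xa]; apply: (lt_le_trans xa); apply: ub_le_sup.
    exact: (overlaps_has_sup v).2.
  by exists a.
apply: bigcup_open => a _.
rewrite (_ : [set _ | _] = (fun v : 'cV[R[i]]_d =>
   complex.Re ((braket a v)^*%C * braket a v)) @^-1` [set y | x < y]); last first.
  by apply/seteqP; split => v /=; rewrite mulJc.
have [c _] : nice (fun v : borelC R d => (braket a v)^*%C * braket a v).
  by apply: niceM; [apply: nice_conj|]; exact: nice_braket.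
by apply: open_comp; [move=> v _; exact: c.1|exact: open_gt].
Qed.

Lemma EgE v : Eg v = - (ln (max_overlap v) / ln 2).
Proof. by []. Qed.

Lemma measurable_Eg_le (r : R) : measurable [set v : borelC R d | Eg (v : 'cV[R[i]]_d) <= r].
Proof.
have mE : measurable_fun setT (fun v : borelC R d => Eg (v : 'cV[R[i]]_d)).
  apply: measurable_funN; apply: measurable_funM; last exact: measurable_cst.
  exact: measurableT_comp (@measurable_ln R) measurable_max_overlap.
rewrite (_ : [set _ | _] = (fun v : borelC R d => Eg (v : 'cV[R[i]]_d)) @^-1` `]-oo, r]).
  by rewrite -[X in measurable X]setTI; exact: mE.
by apply/seteqP; split => v /=; rewrite in_itv.
Qed.

Lemma Eg_le_max_overlap v (r : R) : unit_vec v -> Eg (v : 'cV[R[i]]_d) <= r ->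
  2 `^ (- r) <= max_overlap v.
Proof.
move=> uv; have l2 : 0 < ln 2 :> R by rewrite ln_gt0// ltr1n.
rewrite EgE lerNl ler_pdivlMr// => H.
rewrite -[leRHS]lnK ?posrE ?max_overlap_gt0// /powR pnatr_eq0 /= ler_expR.
exact: H.
Qed.

Lemma Eg_tail_markov (k : nat) (r : R) (nu : probability (borelC R d) R) :
  state_distribution nu ->
  (nu [set v : borelC R d | (Eg (v : 'cV[R[i]]_d) <= r)%R]
   <= (2 `^ (k.+1%:R * r) * \int[nu]_v @class_energy R n k v)%:E)%E.
Proof.
move=> snu; set S := [set v | _]; have mS : measurable S by exact: measurable_Eg_le.
set ce := @class_energy R n k.
have ce0 v : 0 <= ce v.
  by apply: sumr_ge0 => t _; rewrite mulr_ge0 ?invr_ge0 ?ler0n ?sqr_ge0.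
have ice : nu.-integrable setT (EFin \o (fun v : borelC R d => ce v)).
  have := integrable_Re snu (@nice_cclass_energy R n k).
  by apply: eq_integrable => // v _ /=; rewrite /ce class_energyE.
have mce : measurable_fun setT (fun v : borelC R d => (ce v)%:E) := measurable_int nu ice.
have X0 : 0 < 2 `^ (- r) :> R by rewrite powR_gt0.
have H : ((2 `^ (- r) ^+ k.+1)%:E * nu S <= (\int[nu]_v ce v)%:E)%E.
  rewrite -[leRHS](_ : (\int[nu]_v (ce v)%:E)%E = _); last first.
    by rewrite /Rintegral fineK//; exact: (integrable_fin_num measurableT ice).
  rewrite -integral_cst//; apply: (@le_trans _ _ (\int[nu]_(v in S) (ce v)%:E)%E).
    apply: ae_ge0_le_integral => //.
    - by move=> v _; rewrite lee_fin exprn_ge0// ltW.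
    - by move=> v _; rewrite lee_fin.
    - exact: measurable_funTS.
    - apply: (ae_unit snu) => v uv Sv; rewrite lee_fin.
      apply: le_trans (max_overlap_expn_le _ _).
      rewrite ler_pXn2r ?nnegrE ?(ltW X0) ?(ltW (max_overlap_gt0 uv))//.
      exact: Eg_le_max_overlap.
  by apply: ge0_subset_integral => // v _; rewrite lee_fin.
have -> : 2 `^ (k.+1%:R * r) = ((2 `^ (- r)) ^+ k.+1)^-1 :> R.
  by rewrite -powR_mulrn ?powR_ge0// -powRrM -powRN mulNr opprK mulrC.
by rewrite EFinM lee_pdivlMl ?exprn_gt0.
Qed.

End Overlap.

(** * Numerical estimates *)

(** The right side is the falling factorial (k + d - 1) ... d, whose [k] factors are all at least
    [d]. *)
Lemma expn_le_fact_bin (d k : nat) : (0 < d)%N ->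
  (d ^ k <= k`! * 'C(k + d - 1, d - 1))%N.
Proof.
move=> d0; have -> : 'C(k + d - 1, d - 1) = 'C(k + d - 1, k).
  by rewrite -bin_sub; [congr 'C(_, _); lia|lia].
rewrite mulnC bin_ffact; elim: k => [|k IH] //.
have -> : (k.+1 + d - 1 = (k + d - 1).+1)%N by lia.
by rewrite expnS ffactSS leq_mul//; lia.
Qed.

Lemma fact_le_expn (k : nat) : (k`! <= k ^ k)%N.
Proof.
suff H j : (j <= k -> j`! <= k ^ j)%N by exact: H.
by elim: j => // j IH jk; rewrite factS expnS leq_mul// IH// ltnW.
Qed.

(* [(k + 1) / n <= 2 ^ ((k + 1) / n)] gives [(k + 1) ^ n <= n ^ n * 2 ^ (k + 1)]. *)
Lemma class_count_le (n k : nat) : (0 < n)%N ->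
  (k.+1 ^ n <= 2 ^ k * (10 * n) ^ (4 * n))%N.
Proof.
move=> n0; pose q := (k.+1 %/ n)%N.
have kq : (k.+1 <= n * 2 ^ q)%N.
  apply: (@leq_trans (n * q.+1)); last by rewrite leq_mul2l ltn_expl ?orbT.
  by rewrite ltnW// mulnC ltn_ceil.
apply: (@leq_trans ((n * 2 ^ q) ^ n)); first by rewrite leq_exp2r.
rewrite expnMn -expnM mulnC.
apply: (@leq_trans (2 ^ k.+1 * n ^ n)).
  by rewrite leq_mul2r leq_exp2l// leq_trunc_div orbT.
rewrite expnSr -mulnA leq_mul2l; apply/orP; right.
(* The leftover factor 2 is absorbed by one extra factor [10 * n], and [n.+1 <= 4 * n]. *)
apply: (@leq_trans ((10 * n) * (10 * n) ^ n)).
  rewrite leq_mul//; first by lia.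
  by rewrite leq_exp2r//; lia.
by rewrite -expnS leq_pexp2l//; lia.
Qed.

Section Numerics.
Context {R : realType}.
Implicit Types x y : R.

Let ln2_gt0 : 0 < ln 2 :> R.
Proof. by rewrite ln_gt0// ltr1n. Qed.

Lemma powR2_log2 x y : 0 < y -> 2 `^ (x * log2 y) = y `^ x.
Proof.
move=> y0; rewrite /powR pnatr_eq0 /= gt_eqF// /log2 -mulrA divfK//.
by rewrite gt_eqF.
Qed.

Lemma log2M x y : 0 < x -> 0 < y -> log2 (x * y) = log2 x + log2 y.
Proof. by move=> x0 y0; rewrite /log2 lnM ?posrE// mulrDl. Qed.

Lemma log2X x k : 0 < x -> log2 (x ^+ k) = k%:R * log2 x.
Proof. by move=> x0; rewrite /log2 lnXn// -(mulr_natl (ln x)) mulrA. Qed.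

Lemma log2_2 : log2 2 = 1 :> R.
Proof. by rewrite /log2 divff// gt_eqF. Qed.

Lemma log2_ge0 x : 1 <= x -> 0 <= log2 x.
Proof. by move=> x1; rewrite /log2; apply: divr_ge0; [exact: ln_ge0|exact: ltW]. Qed.

Lemma log2_10_le : log2 10 <= 5 :> R.
Proof.
have -> : 5 = log2 (2 ^+ 5) :> R by rewrite log2X// log2_2 mulr1.
rewrite /log2 ler_pM2r ?invr_gt0//.
by rewrite ler_ln ?posrE ?exprn_gt0// -natrX ler_nat.
Qed.

(** The factor 2^(-k delta) is common to both sides and 2^(4n(n - delta)) is at least 1; what
    remains is the inequality [H] between natural numbers. *)
Lemma tail_bound_numeric (n k : nat) (delta : R) : (0 < n)%N -> (0 < k)%N ->
  0 <= n%:R - delta ->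
  2 `^ (k%:R * (n%:R - delta)) * (k.+1 ^ n)%:R / ('C(k + 2 ^ n - 1, 2 ^ n - 1))%:R
  <= 2 `^ (k%:R * log2 (2 * k%:R) + 4 * n%:R * log2 (10 * n%:R)
           - k%:R * delta + 4 * n%:R * (n%:R - delta)).
Proof.
move=> n0 k0 r0.
have k0' : 0 < k%:R :> R by rewrite ltr0n.
have n0' : 0 < n%:R :> R by rewrite ltr0n.
have D a b : 2 `^ (a + b) = 2 `^ a * 2 `^ b :> R by rewrite powRD// pnatr_eq0 implybT.
have C0 : 0 < ('C(k + 2 ^ n - 1, 2 ^ n - 1))%:R :> R.
  by rewrite ltr0n bin_gt0 leq_sub2r// leq_addl.
rewrite mulrBr 4!D powR2_log2 ?mulr_gt0// powR2_log2 ?mulr_gt0//.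
set p := 2 `^ (- _); set q := 2 `^ (4 * _ * (_ - _)).
rewrite -!natrM !powR_mulrn// -!natrX ler_pdivrMr//.
have q1 : 1 <= q.
  by rewrite -[leLHS](powRr0 2) ler_powR ?ler1n// !mulr_ge0// ler0n.
have p0 : 0 <= p by exact: powR_ge0.
have H : (2 ^ (k * n) * k.+1 ^ n <=
    (2 * k) ^ k * (10 * n) ^ (4 * n) * 'C(k + 2 ^ n - 1, 2 ^ n - 1))%N.
  have h1 := expn_le_fact_bin k (expn_gt0 2 n).
  have h2 := fact_le_expn k; have h3 := class_count_le k n0.
  rewrite [(k * n)%N]mulnC expnM (leq_trans (leq_mul h1 h3))// (expnMn 2 k).
  rewrite [leqRHS](_ : _ = k ^ k * 'C(k + 2 ^ n - 1, 2 ^ n - 1) * (2 ^ k * (10 * n) ^ (4 * n)))%N.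
    by rewrite !leq_mul2r h2 !orbT.
  by rewrite [(2 ^ k * _)%N]mulnC -!mulnA; congr muln; rewrite mulnA mulnC.
have {}H : (2 ^ (k * n))%:R * (k.+1 ^ n)%:R <= ((2 * k) ^ k)%:R * ((10 * n) ^ (4 * n))%:R *
    ('C(k + 2 ^ n - 1, 2 ^ n - 1))%:R :> R by rewrite -!natrM ler_nat.
rewrite mulrAC (le_trans (ler_wpM2r p0 H))//.
rewrite -!mulrA !ler_wpM2l ?ler0n// mulrC ler_wpM2l// ler_peMl// ltW.
Qed.

End Numerics.

Theorem theorem6p4 (R : realType) (n : nat) (nuH : probability (borelC R (2 ^ n)) R)
    (n_gt0 : (0 < n)%N) (nuH_unif : uniform_state_distribution nuH) :
  (forall (k : nat) (delta eps : R) (nu : probability (borelC R (2 ^ n)) R),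
     (0 < k)%N -> approx_state_design nuH k eps nu ->
     (nu [set psi : 'cV[R[i]]_(2 ^ n) | (Eg psi <= n%:R - delta)%R]
      <= ((1 + eps) * 2 `^ (k%:R * log2 (2 * k%:R)
                            + 4 * n%:R * log2 (10 * n%:R)
                            - k%:R * delta
                            + 4 * n%:R * (n%:R - delta)))%:E)%E) /\
  (forall nu : probability (borelC R (2 ^ n)) R,
     approx_state_design nuH (n ^ 2)%N 1 nu ->
     (nu [set psi : 'cV[R[i]]_(2 ^ n) | (Eg psi <= n%:R - 3 * log2 n%:R - 5)%R]
      <= (2 * n%:R ^- (n ^ 2)%N)%:E)%E).
Proof.
case: n nuH n_gt0 nuH_unif => // n nuH _ uH.
have part1 (k : nat) (delta eps : R) (nu : probability (borelC R (2 ^ n.+1)) R) :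
    (0 < k)%N -> approx_state_design nuH k eps nu ->
    (nu [set psi : 'cV[R[i]]_(2 ^ n.+1) | (Eg psi <= n.+1%:R - delta)%R]
      <= ((1 + eps) * 2 `^ (k%:R * log2 (2 * k%:R)
                            + 4 * n.+1%:R * log2 (10 * n.+1%:R)
                            - k%:R * delta
                            + 4 * n.+1%:R * (n.+1%:R - delta)))%:E)%E.
  case: k => // k _ dnu; have eps0 := approx_design_eps_ge0 dnu.
  (* When the threshold is negative, a unit vector in the event would have maximal overlap above 1,
     so the event lies in the null complement of the sphere. *)
  have [r0|r0] := leP 0 (n.+1%:R - delta); last first.
    apply: (@le_trans _ _ 0%E); last by rewrite lee_fin mulr_ge0 ?powR_ge0// addr_ge0.
    rewrite -(_ : nu (~` [set v : borelC R (2 ^ n.+1) |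
        unit_vec (v : 'cV[R[i]]_(2 ^ n.+1))]) = 0%E).
      apply: le_measure; rewrite ?inE; first exact: measurable_Eg_le.
        exact: measurableC measurable_unit.
      move=> v /= Ev uv; have := le_trans (Eg_le_max_overlap uv Ev) (max_overlap_le1 uv).
      by apply/negP; rewrite -ltNge /powR pnatr_eq0 expR_gt1 mulr_gt0 ?oppr_gt0 ?ln_gt0 ?ltr1n.
    rewrite probability_setC; last exact: measurable_unit.
    by rewrite (dnu.1 : nu _ = 1%E) subee.
  apply: (le_trans (Eg_tail_markov k _ dnu.1)); rewrite lee_fin.
  apply: (le_trans (ler_wpM2l (powR_ge0 _ _) (integral_class_energy_le uH dnu))).
  apply: le_trans (ler_wpM2l (addr_ge0 ler01 eps0) (tail_bound_numeric _ _ r0)) => //.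
  by rewrite le_eqVlt; apply/orP; left; apply/eqP; ring.
split=> // nu dnu.
have n1 : 1 <= n.+1%:R :> R by rewrite ler1n.
have n0 : 0 < n.+1%:R :> R by rewrite ltr0n.
set L := log2 n.+1%:R; have L0 : 0 <= L by exact: log2_ge0.
have := part1 (n.+1 ^ 2)%N (3 * L + 5) 1 nu isT dnu.
rewrite opprD addrA => /le_trans; apply; rewrite lee_fin ler_wpM2l//.
have -> : n.+1%:R ^- (n.+1 ^ 2) = 2 `^ (- (n.+1%:R ^+ 2 * L)) :> R.
  by rewrite powRN powR2_log2// -[X in _ `^ X]natrX powR_mulrn.
rewrite ler_powR ?ler1n// natrX log2M ?exprn_gt0// log2X// log2M// log2_2 -/L.
(* Writing N for [n.+1], the exponent equals -N^2 L - 4N (5 + 2L - log2 10): the quadratic terms 1 +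
   2L - (3L + 5) + 4 collapse to -L, and the linear remainder has a favourable sign. *)
have le10 : 0 <= 4 * n.+1%:R * (5 + 2 * L - log2 10).
  by rewrite !mulr_ge0 ?ler0n// subr_ge0 (le_trans log2_10_le)// lerDl mulr_ge0.
rewrite -subr_ge0; apply: le_trans le10 _; rewrite le_eqVlt; apply/orP; left.
by apply/eqP; ring.
Qed.
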